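(* Let $Q$ be a cluster quiver whose underlying graph is one of the Dynkin diagrams $A_n$ ($n\ge1$), $D_n$ ($n\ge4$), $E_6$, $E_7$, $E_8$. Then the preprojective algebra $\Theta(Q)$ of $Q$ is representation-finite if and only if $Q$ is $2$-maximal.
   Context: A cluster quiver is a finite quiver (multiple arrows allowed) without loops or oriented 2-cycles. Its exchange matrix $B(Q)=(b_{ij})$ is the integer skew-symmetric matrix with $b_{ij}$ equal to the number of arrows $i\to j$ minus the number of arrows $j\to i$. The mutation $\mu_k(Q)$ at a vertex $k$ is the cluster quiver whose exchange matrix $(b'_{ij})$ is given by $b'_{ij}=-b_{ij}$ if $i=k$ or $j=k$, and $b'_{ij}=b_{ij}+\mathrm{sgn}(b_{ik})\max\{b_{ik}b_{kj},0\}$ otherwise. Two cluster quivers are mutation equivalent if one is obtained from the other by a finite sequence of mutations (quivers being considered up to relabelling of vertices). The exchange spectrum radius is the maximum modulus of the eigenvalues of the exchange matrix. $Q$ is $2$-maximal if every cluster quiver mutation equivalent to $Q$ has exchange spectrum radius at most $2$. Preprojective algebra: let $K$ be an algebraically closed field. Let $\tilde Q$ be the quiver obtained from $Q$ by adjoining, for each arrow $\alpha:i\to j$ of $Q$, an arrow $\sigma(\alpha):j\to i$; extend $\sigma$ to an involution on the arrows of $\tilde Q$ by $\sigma(\sigma(\alpha))=\alpha$. The path algebra $K\tilde Q$ has the paths as basis, a product of paths $\omega_1\omega_2$ being their concatenation ($\omega_1$ first, then $\omega_2$) if the target of $\omega_1$ equals the source of $\omega_2$, and $0$ otherwise. In the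 preprojective algebra, $\sigma(\beta)\beta$ is thus a closed path at the target $t(\beta)$ of $\beta$, and $\Theta(Q)$ is the quotient of $K\tilde Q$ by the two-sided ideal generated by the elements $\sum_{t(\beta)=i}\sigma(\beta)\beta$ for all vertices $i$ of $\tilde Q$, with $\beta$ ranging over the arrows of $\tilde Q$ with target $i$. An algebra is representation-finite if it has only finitely many isomorphism classes of finite-dimensional indecomposable modules. *)

(* Defs.v *)
From HB Require Import structures.
From mathcomp Require Import all_boot all_order all_fingroup all_algebra all_field.
From mathcomp Require Import finmap.
From mathcomp.multinomials Require Import monalg.
From mathcomp.classical Require Import boolp.

Set Implicit Arguments.
Unset Strict Implicit.
Unset Printing Implicit Defensive.

Import Order.TTheory GRing.Theory Num.Theory.

Local Open Scope ring_scope.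

Record quiver (n : nat) := Quiver {
  arrow : finType;
  source : arrow -> 'I_n;
  target : arrow -> 'I_n }.

Definition nb_arrows n (Q : quiver n) (i j : 'I_n) : nat :=
  #|[set a : arrow Q | (source a == i) && (target a == j)]|.

Definition nb_edges n (Q : quiver n) (i j : 'I_n) : nat :=
  #|[set a : arrow Q | ((source a == i) && (target a == j))
                    || ((source a == j) && (target a == i))]|.

Definition exchange_mx n (Q : quiver n) : 'M[int]_n :=
  \matrix_(i, j) ((nb_arrows Q i j)%:Z - (nb_arrows Q j i)%:Z).

Definition quiver_iso n (Q Q' : quiver n) : Prop :=
  exists (s : 'S_n) (f : arrow Q -> arrow Q'), bijective f /\
    forall a, source (f a) = s (source a) /\ target (f a) = s (target a).

Definition loopless n (Q : quiver n) : Prop :=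
  forall a : arrow Q, source a <> target a.

Definition no_2cycle n (Q : quiver n) : Prop :=
  forall a b : arrow Q, ~ (target a = source b /\ target b = source a).

Record cluster_quiver (n : nat) := ClusterQuiver {
  cq_quiver :> quiver n;
  cq_loopless : loopless cq_quiver;
  cq_no_2cycle : no_2cycle cq_quiver }.

Definition skew n (B : 'M[int]_n) : Prop := forall i j, B j i = - B i j.

Lemma exchange_mx_skew n (Q : quiver n) : skew (exchange_mx Q).
Proof. by move=> i j; rewrite !mxE opprB. Qed.

(* The quiver with max(b_ij, 0) arrows from i to j: up to isomorphism, the only
   cluster quiver with exchange matrix B when B is skew-symmetric. *)
Definition quiver_of_mx n (B : 'M[int]_n) : quiver n :=
  @Quiver n {x : 'I_n * 'I_n & 'I_(absz (Num.max (B x.1 x.2) 0))}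
    (fun a => (tag a).1) (fun a => (tag a).2).

Lemma nb_arrows_of_mx n (B : 'M[int]_n) i j :
  nb_arrows (quiver_of_mx B) i j = absz (Num.max (B i j) 0).
Proof.
rewrite /nb_arrows -[RHS]card_ord.
set T := 'I_ _.
pose f (k : T) : arrow (quiver_of_mx B) :=
  existT (fun x : 'I_n * 'I_n => 'I_(absz (Num.max (B x.1 x.2) 0))) (i, j) k.
rewrite -(card_imset (f := f) T) /=; last first.
  by move=> k l /eqP; rewrite /f -tag_eqE /tag_eq eqxx /= tagged_asE => /eqP.
apply: eq_card => -[[i' j'] k] /=; rewrite !inE /=.
apply/andP/imsetP => /= [[/eqP ei /eqP ej]|[l _ e]].
  by subst i' j'; exists k.
by move/(congr1 (@tag _ _)): e => /= -[-> ->].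
Qed.

Lemma arrow_of_mx_gt0 n (B : 'M[int]_n) (a : arrow (quiver_of_mx B)) :
  0 < B (source a) (target a).
Proof.
case: a => [[i j] k] /=; move: k => /=.
case: (ltP 0 (B i j)) => // h; by case.
Qed.

Lemma exchange_of_mx n (B : 'M[int]_n) :
  skew B -> exchange_mx (quiver_of_mx B) = B.
Proof.
move=> sB; apply/matrixP => i j; rewrite mxE !nb_arrows_of_mx (sB i j).
rewrite !gez0_abs ?le_max ?lexx ?orbT //.
case: (leP 0 (B i j)) => h.
- by rewrite max_r ?subr0 // oppr_le0.
- by rewrite max_l ?sub0r ?opprK // oppr_ge0 ltW.
Qed.

Lemma quiver_of_mx_loopless n (B : 'M[int]_n) :
  skew B -> loopless (quiver_of_mx B).
Proof.
move=> sB a e; have := arrow_of_mx_gt0 a; rewrite e.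
move: (target a) => t; have := sB t t => /eqP.
by rewrite -addr_eq0 -mulr2n mulrn_eq0 /= => /eqP ->.
Qed.

Lemma quiver_of_mx_no_2cycle n (B : 'M[int]_n) :
  skew B -> no_2cycle (quiver_of_mx B).
Proof.
move=> sB a b [e1 e2].
have := arrow_of_mx_gt0 b; rewrite e2 -e1 sB oppr_gt0.
by move/lt_trans/(_ (arrow_of_mx_gt0 a)); rewrite ltxx.
Qed.

Definition mutate_mx n (B : 'M[int]_n) (k : 'I_n) : 'M[int]_n :=
  \matrix_(i, j) if (i == k) || (j == k) then - B i j
                 else B i j + Num.sg (B i k) * Num.max (B i k * B k j) 0.

Lemma mutate_mx_skew n (B : 'M[int]_n) k : skew B -> skew (mutate_mx B k).
Proof.
move=> sB i j; rewrite !mxE orbC; case: ifP => _; first by rewrite sB.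
rewrite (sB i j) (sB k j) (sB i k) mulrNN [B k j * B i k]mulrC opprD; congr +%R.
case: (leP (B i k * B k j) 0) => h; first by rewrite !mulr0 oppr0.
rewrite -mulNr; congr (_ * _); rewrite sgrN; congr -%R.
case: (ltgtP 0 (B i k)) h => [b|b|<-]; last by rewrite mul0r ltxx.
- by rewrite pmulr_rgt0 // => c; rewrite !gtr0_sg.
- by rewrite nmulr_rgt0 // => c; rewrite !ltr0_sg.
Qed.

Definition mutation n (Q : cluster_quiver n) (k : 'I_n) : cluster_quiver n :=
  let sB := mutate_mx_skew k (exchange_mx_skew Q) in
  ClusterQuiver (quiver_of_mx_loopless sB) (quiver_of_mx_no_2cycle sB).

Lemma exchange_mutation n (Q : cluster_quiver n) k :
  exchange_mx (mutation Q k) = mutate_mx (exchange_mx Q) k.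
Proof. by apply/exchange_of_mx/mutate_mx_skew/exchange_mx_skew. Qed.

Definition mutation_equivalent n (Q Q' : cluster_quiver n) : Prop :=
  exists ks : seq 'I_n, quiver_iso (foldl (@mutation n) Q ks) Q'.

(* Eigenvalues of integer matrices are algebraic, so algC is large enough. *)
Definition eigenvalues n (M : 'M[algC]_n) : seq algC :=
  sval (closed_field_poly_normal (char_poly M)).

Lemma mem_eigenvalues n (M : 'M[algC]_n) a :
  (a \in eigenvalues M) = eigenvalue M a.
Proof.
rewrite eigenvalue_root_char /eigenvalues; case: closed_field_poly_normal => r /= e.
by rewrite e (monicP (char_poly_monic M)) scale1r root_prod_XsubC.
Qed.

Definition exchange_spectrum_radius n (Q : quiver n) : algC :=
  \big[Num.max/0]_(z <- eigenvalues (map_mx intr (exchange_mx Q))) `|z|.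

Lemma exchange_spectrum_radius_le n (Q : quiver n) (r : algC) : 0 <= r ->
  exchange_spectrum_radius Q <= r <->
  forall a, eigenvalue (map_mx intr (exchange_mx Q)) a -> `|a| <= r.
Proof.
move=> r0; rewrite /exchange_spectrum_radius; set M := map_mx _ _.
have -> : (\big[Num.max/0]_(z <- eigenvalues M) `|z| <= r)
        = all (fun z => `|z| <= r) (eigenvalues M).
  have : forall s : seq algC, (\big[Num.max/0]_(z <- s) `|z| \is Num.real) &&
      ((\big[Num.max/0]_(z <- s) `|z| <= r) == all (fun z => `|z| <= r) s).
    elim=> [|z s /andP[re /eqP IH]]; first by rewrite big_nil real0 r0.
    rewrite big_cons max_real ?normr_real //=.
    by rewrite comparable_ge_max ?IH // real_comparable ?normr_real.
  by move/(_ (eigenvalues M))/andP => -[_ /eqP].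
split=> [/allP h a|h]; first by rewrite -mem_eigenvalues; apply: h.
by apply/allP => a; rewrite mem_eigenvalues; apply: h.
Qed.

Definition two_maximal n (Q : cluster_quiver n) : Prop :=
  forall Q' : cluster_quiver n,
    mutation_equivalent Q Q' -> exchange_spectrum_radius Q' <= 2.

Inductive dynkin_family := DynkinA | DynkinD | DynkinE.

Definition dynkin_rank (X : dynkin_family) (n : nat) : bool :=
  match X with
  | DynkinA => 1 <= n
  | DynkinD => 4 <= n
  | DynkinE => 6 <= n <= 8
  end%N.

(* The chain 0 - 1 - ... - (n - 2), with vertex n - 1 attached to vertex b. *)
Definition branched_edge (b n i j : nat) : bool :=
  if j.+1 == n then i == b else j == i.+1.

Definition dynkin_edge (X : dynkin_family) (n i j : nat) : bool :=
  match X with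
  | DynkinA => j == i.+1
  | DynkinD => branched_edge (n - 3) n i j
  | DynkinE => branched_edge 2 n i j
  end.

Definition dynkin_adj (X : dynkin_family) (n i j : nat) : bool :=
  dynkin_edge X n i j || dynkin_edge X n j i.

Definition dynkin_quiver n (Q : quiver n) : Prop :=
  exists2 X : dynkin_family, dynkin_rank X n &
    exists s : 'S_n, forall i j : 'I_n,
      nb_edges Q (s i) (s j) = dynkin_adj X n i j.

Section Paths.
Variables (n : nat) (Q : quiver n).

Fixpoint walk (i : 'I_n) (s : seq (arrow Q)) : bool :=
  if s is a :: s' then (source a == i) && walk (target a) s' else true.

(* A path is its starting vertex together with its successive arrows; the
   starting vertex tells the trivial paths apart. *)
Record qpath := QPath {
  qpath_val : 'I_n * seq (arrow Q);
  _ : walk qpath_val.1 qpath_val.2 }.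

HB.instance Definition _ := [isSub for qpath_val].
HB.instance Definition _ := [Choice of qpath by <:].

Definition qpath_source (p : qpath) : 'I_n := (val p).1.
Definition qpath_target (p : qpath) : 'I_n :=
  last (val p).1 (map (@target n Q) (val p).2).

Definition trivial_path (i : 'I_n) : qpath := @QPath (i, [::]) isT.

Lemma arrow_path_subproof (a : arrow Q) : walk (source a) [:: a].
Proof. by rewrite /= eqxx. Qed.

Definition arrow_path (a : arrow Q) : qpath :=
  @QPath (source a, [:: a]) (arrow_path_subproof a).

Lemma walk_cat i s t :
  walk i (s ++ t) = walk i s && walk (last i (map (@target n Q) s)) t.
Proof. by elim: s i => //= a s IH i; rewrite IH andbA. Qed.

Lemma qpath_cat_subproof (p q : qpath) : qpath_target p = qpath_source q ->
  walk (val p).1 ((val p).2 ++ (val q).2).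
Proof.
case: p q => [[i s] /= ws] [[j t] /= wt]; rewrite /qpath_target /qpath_source /=.
by move=> e; rewrite walk_cat ws e.
Qed.

(* Concatenation, p first and then q; None stands for the zero product of
   non-composable paths. *)
Definition qpath_cat (p q : qpath) : option qpath :=
  if qpath_target p =P qpath_source q is ReflectT e
  then Some (@QPath ((val p).1, (val p).2 ++ (val q).2) (qpath_cat_subproof e))
  else None.

Lemma qpath_catP p q r : qpath_cat p q = Some r <->
  qpath_target p = qpath_source q /\
  val r = ((val p).1, (val p).2 ++ (val q).2).
Proof.
rewrite /qpath_cat; case: eqP => [e|ne]; split=> //.
- by move=> [<-].
- by move=> [_ er]; congr Some; apply: val_inj.
- by case.
Qed.

Lemma qpath_cat_None p q :
  qpath_target p <> qpath_source q -> qpath_cat p q = None.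
Proof. by rewrite /qpath_cat; case: eqP. Qed.

Lemma qpath_cat_source p q r :
  qpath_cat p q = Some r -> qpath_source r = qpath_source p.
Proof. by move=> /qpath_catP[_]; rewrite /qpath_source => ->. Qed.

Lemma qpath_cat_target p q r :
  qpath_cat p q = Some r -> qpath_target r = qpath_target q.
Proof.
move=> /qpath_catP[]; rewrite /qpath_target /qpath_source => e ->.
by rewrite /= map_cat last_cat e.
Qed.

Lemma qpath_catA p q r :
  obind (fun pq => qpath_cat pq r) (qpath_cat p q) =
  obind (fun qr => qpath_cat p qr) (qpath_cat q r).
Proof.
case epq: (qpath_cat p q) => [pq|] /=; case eqr: (qpath_cat q r) => [qr|] //=.
- have [e1 v1] := (qpath_catP _ _ _).1 epq.
  have [e2 v2] := (qpath_catP _ _ _).1 eqr.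
  case epqr: (qpath_cat pq r) => [x|]; last first.
    move: epqr; rewrite /qpath_cat; case: eqP => // ne _.
    by case: ne; rewrite (qpath_cat_target epq).
  have [_ v3] := (qpath_catP _ _ _).1 epqr.
  apply/esym/qpath_catP; split; first by rewrite (qpath_cat_source eqr).
  by rewrite v3 v1 v2 /= catA.
- apply: qpath_cat_None; rewrite (qpath_cat_target epq) => e.
  by move: eqr; rewrite /qpath_cat; case: eqP.
- apply/esym/qpath_cat_None; rewrite (qpath_cat_source eqr) => e.
  by move: epq; rewrite /qpath_cat; case: eqP.
Qed.

Lemma qpath_cat1p i p :
  qpath_cat (trivial_path i) p = if i == qpath_source p then Some p else None.
Proof.
case: eqP => [e|ne]; last exact: qpath_cat_None.
apply/qpath_catP; split => //=; rewrite e /qpath_source.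
by rewrite -surjective_pairing.
Qed.

Lemma qpath_catp1 i p :
  qpath_cat p (trivial_path i) = if i == qpath_target p then Some p else None.
Proof.
case: eqP => [e|ne]; last by apply: qpath_cat_None => e; case: ne.
apply/qpath_catP; split => //=; rewrite cats0.
by rewrite -surjective_pairing.
Qed.

Lemma qpath_cat_trivial p q i : qpath_cat p q = Some (trivial_path i) ->
  p = trivial_path i /\ q = trivial_path i.
Proof.
case: p q => [[j s] ws] [[k t] wt] /qpath_catP /= [e [ei]].
case: s t ws wt e => [|//] [|//] ws wt; rewrite /qpath_target /qpath_source /=.
by move=> e _; split; apply: val_inj => /=; rewrite ei ?e.
Qed.

End Paths.

Lemma malg_sumE (R : nzRingType) (T : choiceType) (x : {malg R[T]}) :
  x = \sum_(p <- msupp x) mcoeff p x *: << p >>.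
Proof.
rewrite {1}[x]monalgE; apply: eq_bigr => p _; apply/malgP => q.
by rewrite mcoeffZ !mcoeffU mulr_natr.
Qed.

Definition path_algebra (K : fieldType) (n : nat) (Q : quiver n) : Type :=
  {malg K[qpath Q]}.

(* Locked, as comparing the underlying finite maps by conversion diverges. *)
HB.lock Definition path_elt (K : fieldType) (n : nat) (Q : quiver n)
  (p : qpath Q) : path_algebra K Q := << p >>.

Section PathAlgebraModule.
Variables (K : fieldType) (n : nat) (Q : quiver n).

HB.instance Definition _ := GRing.Lmodule.copy (path_algebra K Q) {malg K[qpath Q]}.

Local Notation A := (path_algebra K Q).
Local Notation path_elt := (@path_elt K n Q).

Definition lin_ext (V : lmodType K) (f : qpath Q -> V) (x : A) : V :=
  \sum_(p <- msupp x) mcoeff p x *: f p.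

Lemma lin_extEw (V : lmodType K) (f : qpath Q -> V) (x : A) (d : {fset qpath Q}) :
  (msupp x `<=` d)%fset -> lin_ext f x = \sum_(p <- d) mcoeff p x *: f p.
Proof.
move=> le; rewrite /lin_ext; apply: big_fset_incl => // p _.
by rewrite -mcoeff_eq0 => /eqP ->; rewrite scale0r.
Qed.

Lemma lin_ext_is_linear (V : lmodType K) (f : qpath Q -> V) : linear (lin_ext f).
Proof.
move=> k x y.
pose d := (msupp (k *: x + y : {malg K[qpath Q]}) `|` msupp x `|` msupp y)%fset.
have h1 : (msupp (k *: x + y : {malg K[qpath Q]}) `<=` d)%fset.
  by apply/fsubsetP => p hp; rewrite !inE hp.
have h2 : (msupp x `<=` d)%fset.
  by apply/fsubsetP => p hp; rewrite !inE hp orbT.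
have h3 : (msupp y `<=` d)%fset.
  by apply/fsubsetP => p hp; rewrite !inE hp orbT.
rewrite (lin_extEw f h1) (lin_extEw f h2) (lin_extEw f h3).
rewrite scaler_sumr -big_split /=; apply: eq_bigr => p _.
by rewrite mcoeffD mcoeffZ scalerDl scalerA.
Qed.

HB.instance Definition _ (V : lmodType K) (f : qpath Q -> V) :=
  GRing.isLinear.Build K A V _ (lin_ext f) (@lin_ext_is_linear V f).

Lemma lin_ext_elt (V : lmodType K) (f : qpath Q -> V) p :
  lin_ext f (path_elt p) = f p.
Proof.
rewrite path_elt.unlock (lin_extEw f (msuppU_le (x := 1))) big_seq_fset1.
by rewrite mcoeffUU scale1r.
Qed.

Lemma path_algebra_sumE (x : A) :
  x = \sum_(p <- msupp x) mcoeff p x *: path_elt p.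
Proof. by rewrite {1}[x]malg_sumE; apply: eq_bigr => p _; rewrite path_elt.unlock. Qed.

Lemma mcoeff_elt (p q : qpath Q) : mcoeff q (path_elt p) = (p == q)%:R.
Proof. by rewrite path_elt.unlock mcoeffU. Qed.

Lemma lin_extP (V : lmodType K) (f g : {linear A -> V}) :
  (forall p, f (path_elt p) = g (path_elt p)) -> f =1 g.
Proof.
move=> fg x.
rewrite [x]path_algebra_sumE.
by rewrite !linear_sum; apply: eq_bigr => p _; rewrite !linearZ_LR fg.
Qed.

Definition basis_mul (p q : qpath Q) : A := oapp path_elt 0 (qpath_cat p q).

End PathAlgebraModule.

HB.lock Definition path_mul (K : fieldType) (n : nat) (Q : quiver n)
    (x y : path_algebra K Q) : path_algebra K Q :=
  lin_ext (fun p => lin_ext (basis_mul K p) y) x.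

Section PathAlgebraMul.
Variables (K : fieldType) (n : nat) (Q : quiver n).
Local Notation A := (path_algebra K Q).
Local Notation path_elt := (@path_elt K n Q).
Local Notation path_mul := (@path_mul K n Q).
Local Notation basis_mul := (@basis_mul K n Q).

Definition path_one : A := \sum_(i < n) path_elt (trivial_path Q i).

Lemma path_mul_linearl y : linear (path_mul^~ y).
Proof. by move=> k x x'; rewrite path_mul.unlock linearP. Qed.

Lemma path_mul_linearr x : linear (path_mul x).
Proof.
move=> k y y'; rewrite path_mul.unlock /lin_ext scaler_sumr -big_split /=.
apply: eq_bigr => p _.
by rewrite -/(lin_ext _ _) linearP scalerDr !scalerA mulrC.
Qed.

Definition path_rmul (y x : A) : A := path_mul x y.

HB.instance Definition _ y :=
  GRing.isLinear.Build K A A _ (path_rmul y) (path_mul_linearl y).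
HB.instance Definition _ x :=
  GRing.isLinear.Build K A A _ (path_mul x) (path_mul_linearr x).

Lemma path_mul_elt p q : path_mul (path_elt p) (path_elt q) = basis_mul p q.
Proof. by rewrite path_mul.unlock !lin_ext_elt. Qed.

Lemma path_mul_basisl p q r :
  path_mul (basis_mul p q) (path_elt r) =
  oapp path_elt 0 (obind (fun pq => qpath_cat pq r) (qpath_cat p q)).
Proof.
rewrite {1}/basis_mul; case: qpath_cat => [s|] /=; first by rewrite path_mul_elt.
exact: (linear0 (path_rmul (path_elt r))).
Qed.

Lemma path_mul_basisr p q r :
  path_mul (path_elt p) (basis_mul q r) =
  oapp path_elt 0 (obind (fun qr => qpath_cat p qr) (qpath_cat q r)).
Proof.
rewrite {1}/basis_mul; case: qpath_cat => [s|] /=; first by rewrite path_mul_elt.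
exact: (linear0 (path_mul (path_elt p))).
Qed.

Lemma path_mulA : associative path_mul.
Proof.
move=> x y z.
pose mull t : {linear A -> A} := path_rmul t.
pose mulr t : {linear A -> A} := path_mul t.
suff h p : path_mul (path_elt p) (path_mul y z)
         = path_mul (path_mul (path_elt p) y) z.
  exact: (lin_extP (f := mull (path_mul y z)) (g := mull z \o mull y) h).
suff {y} h q : path_mul (path_elt p) (path_mul (path_elt q) z)
         = path_mul (path_mul (path_elt p) (path_elt q)) z.
  exact: (lin_extP (f := mulr (path_elt p) \o mull z)
                   (g := mull z \o mulr (path_elt p)) h).
suff {z} h r : path_mul (path_elt p) (path_mul (path_elt q) (path_elt r))
         = path_mul (path_mul (path_elt p) (path_elt q)) (path_elt r).
  exact: (lin_extP (f := mulr (path_elt p) \o mulr (path_elt q))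
                   (g := mulr (path_mul (path_elt p) (path_elt q))) h).
by rewrite !path_mul_elt path_mul_basisl path_mul_basisr qpath_catA.
Qed.

Lemma path_mul1 : left_id path_one path_mul.
Proof.
pose mulr t : {linear A -> A} := path_mul t.
apply: (lin_extP (f := mulr path_one) (g := idfun)) => p /=.
rewrite -[LHS]/(path_rmul (path_elt p) path_one) linear_sum /= /path_rmul.
rewrite (bigD1 (qpath_source p)) //= path_mul_elt /basis_mul qpath_cat1p eqxx /=.
rewrite big1 ?addr0 // => i ne.
by rewrite path_mul_elt /basis_mul qpath_cat1p (negPf ne).
Qed.

Lemma path_mulr1 : right_id path_one path_mul.
Proof.
apply: (lin_extP (f := path_rmul path_one) (g := idfun)) => p /=.
rewrite /path_rmul linear_sum /=.
rewrite (bigD1 (qpath_target p)) //= path_mul_elt /basis_mul qpath_catp1 eqxx /=.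
rewrite big1 ?addr0 // => i ne.
by rewrite path_mul_elt /basis_mul qpath_catp1 (negPf ne).
Qed.

Lemma path_mulDl : left_distributive path_mul +%R.
Proof. by move=> x y z; exact: (linearD (path_rmul z)). Qed.

Lemma path_mulDr : right_distributive path_mul +%R.
Proof. by move=> x y z; rewrite linearD. Qed.

Lemma mcoeff_trivial_mul i (x y : A) :
  mcoeff (trivial_path Q i) (path_mul x y) =
  mcoeff (trivial_path Q i) x * mcoeff (trivial_path Q i) y.
Proof.
set t := trivial_path Q i.
have mE (u : A) : mcoeff t u = \sum_(p <- msupp u) mcoeff p u * (p == t)%:R.
  rewrite {1}[u]path_algebra_sumE raddf_sum /=; apply: eq_bigr => p _.
  by rewrite mcoeffZ mcoeff_elt.
have mbasis p q : mcoeff t (basis_mul p q) = (p == t)%:R * (q == t)%:R.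
  rewrite /basis_mul -natrM mulnb; case e: (qpath_cat p q) => [r|] /=.
    rewrite mcoeff_elt; congr (_%:R); case: (r =P t) => [er|ne].
      by move: e; rewrite er => /qpath_cat_trivial[-> ->]; rewrite eqxx.
    case: andP => // -[/eqP ep /eqP eq].
    by move: e; rewrite ep eq qpath_cat1p eqxx => -[/esym].
  rewrite mcoeff0; case: andP => // -[/eqP ep /eqP eq].
  by move: e; rewrite ep eq qpath_cat1p eqxx.
rewrite (mE x) mulr_suml {1}[x]path_algebra_sumE.
rewrite -[path_mul _ y]/(path_rmul y _) linear_sum raddf_sum /=.
apply: eq_bigr => p _; rewrite linearZ_LR mcoeffZ -mulrA; congr (_ * _).
rewrite /= /path_rmul (mE y) mulr_sumr {1}[y]path_algebra_sumE.
rewrite linear_sum raddf_sum /=; apply: eq_bigr => q _.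
by rewrite linearZ_LR /= mcoeffZ path_mul_elt mbasis mulrCA.
Qed.

End PathAlgebraMul.

(* At least one vertex, so that the path algebra is a nonzero ring, as algType
   requires. *)
Section PathAlgebra.
Variables (K : fieldType) (n : nat) (Q : quiver n.+1).
Local Notation A := (path_algebra K Q).

Lemma mcoeff_trivial_one i : mcoeff (trivial_path Q i) (path_one K Q) = 1.
Proof.
rewrite /path_one raddf_sum /= (bigD1 i) //= mcoeff_elt eqxx big1 ?addr0 // => j ne.
rewrite mcoeff_elt; case: eqP => // /(congr1 (@qpath_source _ Q)).
by rewrite /qpath_source /= => e; rewrite e eqxx in ne.
Qed.

Lemma path_one_neq0 : path_one K Q != 0.
Proof.
apply/eqP => /(congr1 (mcoeff (trivial_path Q ord0))).
by rewrite mcoeff_trivial_one mcoeff0 => /eqP; rewrite oner_eq0.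
Qed.

HB.instance Definition _ := GRing.Zmodule_isNzRing.Build A
  (@path_mulA K _ Q) (@path_mul1 K _ Q) (@path_mulr1 K _ Q)
  (@path_mulDl K _ Q) (@path_mulDr K _ Q) path_one_neq0.

Lemma path_scaleAl (k : K) (x y : A) : k *: (x * y) = (k *: x) * y.
Proof. exact: (esym (linearZ_LR (path_rmul y) k x)). Qed.

Lemma path_scaleAr (k : K) (x y : A) : k *: (x * y) = x * (k *: y).
Proof. exact: (esym (linearZ_LR (path_mul x) k y)). Qed.

HB.instance Definition _ := GRing.Lmodule_isLalgebra.Build K A path_scaleAl.
HB.instance Definition _ := GRing.Lalgebra_isAlgebra.Build K A path_scaleAr.

Definition arrow_elt (a : arrow Q) : A := path_elt K (arrow_path a).

End PathAlgebra.

(* inl a is the arrow a of Q and inr a is the adjoined arrow sigma(a). *)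
Definition double_quiver n (Q : quiver n) : quiver n :=
  @Quiver n (arrow Q + arrow Q)%type
    (fun b => match b with inl a => source a | inr a => target a end)
    (fun b => match b with inl a => target a | inr a => source a end).

Definition sigma n (Q : quiver n) (b : arrow (double_quiver Q)) :
    arrow (double_quiver Q) :=
  match b with inl a => inr a | inr a => inl a end.

Lemma sigmaK n (Q : quiver n) : involutive (@sigma n Q).
Proof. by case. Qed.

Section Preprojective.
Variables (K : fieldType) (n : nat) (Q : quiver n.+1).
Local Notation A := (path_algebra K (double_quiver Q)).

Definition preproj_relation (i : 'I_n.+1) : A :=
  \sum_(b : arrow (double_quiver Q) | target b == i)
     arrow_elt K (sigma b) * arrow_elt K b.

Definition in_preproj_ideal (x : A) : Prop :=
  exists s : seq (A * 'I_n.+1 * A),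
    x = \sum_(t <- s) t.1.1 * preproj_relation t.1.2 * t.2.

Definition preproj_ideal : {pred A} := fun x => `[< in_preproj_ideal x >].

Lemma preproj_idealP x : reflect (in_preproj_ideal x) (x \in preproj_ideal).
Proof. exact: asboolP. Qed.

Lemma preproj_idealMl a x : x \in preproj_ideal -> a * x \in preproj_ideal.
Proof.
move=> /preproj_idealP[s ->]; apply/preproj_idealP.
exists [seq (a * t.1.1, t.1.2, t.2) | t <- s].
by rewrite big_map mulr_sumr; apply: eq_bigr => t _; rewrite !mulrA.
Qed.

Lemma preproj_idealMr a x : x \in preproj_ideal -> x * a \in preproj_ideal.
Proof.
move=> /preproj_idealP[s ->]; apply/preproj_idealP.
exists [seq (t.1.1, t.1.2, t.2 * a) | t <- s].
by rewrite big_map mulr_suml; apply: eq_bigr => t _; rewrite !mulrA.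
Qed.

Lemma preproj_ideal_zmod : zmod_closed preproj_ideal.
Proof.
split; first by apply/preproj_idealP; exists [::]; rewrite big_nil.
move=> x y hx hy.
have := preproj_idealMl (-1) hy; rewrite mulN1r => /preproj_idealP[t ->].
move: hx => /preproj_idealP[s ->]; apply/preproj_idealP; exists (s ++ t).
by rewrite big_cat.
Qed.

HB.instance Definition _ := GRing.isZmodClosed.Build A preproj_ideal
  preproj_ideal_zmod.

Lemma preproj_ideal1 : 1 \notin preproj_ideal.
Proof.
apply/negP => /preproj_idealP[s].
pose e := trivial_path (double_quiver Q) (ord0 : 'I_n.+1).
move=> /(congr1 (mcoeff e)); rewrite mcoeff_trivial_one raddf_sum /= big1.
  by move/eqP; rewrite oner_eq0.
move=> t _; rewrite [LHS]mcoeff_trivial_mul [X in X * _]mcoeff_trivial_mul.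
rewrite [X in _ * X * _](_ : _ = 0) ?mulr0 ?mul0r //.
rewrite raddf_sum big1 //= => b _.
rewrite [LHS]mcoeff_trivial_mul [X in X * _]mcoeff_elt.
by rewrite -val_eqE /= xpair_eqE andbF mul0r.
Qed.

Definition preprojective : Type := Quotient.quot preproj_ideal.

HB.instance Definition _ := GRing.Zmodule.on preprojective.
HB.instance Definition _ := EqQuotient.on preprojective.

Definition preproj_pi (x : A) : preprojective := (\pi_(Quotient.quot preproj_ideal) x)%qT.

Lemma preproj_piP x y : preproj_pi x = preproj_pi y <-> x - y \in preproj_ideal.
Proof.
rewrite (Quotient.idealrBE preproj_ideal x y).
by split => [e|/eqP //]; apply/eqP.
Qed.

Definition preproj_repr (u : preprojective) : A := generic_quotient.repr u.

Lemma preproj_reprK u : preproj_pi (preproj_repr u) = u.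
Proof. exact: reprK. Qed.

Lemma preproj_pi_repr x : preproj_repr (preproj_pi x) - x \in preproj_ideal.
Proof. by apply/preproj_piP; rewrite preproj_reprK. Qed.

Lemma preproj_pi_is_zmod_morphism : zmod_morphism preproj_pi.
Proof. by move=> x y; rewrite /preproj_pi; exact: (raddfB (\pi_(Quotient.quot preproj_ideal))%qT). Qed.

HB.instance Definition _ :=
  GRing.isZmodMorphism.Build A preprojective preproj_pi
    preproj_pi_is_zmod_morphism.

Definition preproj_one : preprojective := preproj_pi 1.
Definition preproj_mul (u v : preprojective) : preprojective :=
  preproj_pi (preproj_repr u * preproj_repr v).
Definition preproj_scale (k : K) (u : preprojective) : preprojective :=
  preproj_pi (k *: preproj_repr u).

Lemma preproj_pi_mul x y :
  preproj_mul (preproj_pi x) (preproj_pi y) = preproj_pi (x * y).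
Proof.
apply/preproj_piP; set x' := preproj_repr _; set y' := preproj_repr _.
have -> : x' * y' - x * y = x' * (y' - y) + (x' - x) * y.
  by rewrite mulrBr mulrBl addrA subrK.
by apply: rpredD; [apply: preproj_idealMl | apply: preproj_idealMr];
  exact: preproj_pi_repr.
Qed.

Lemma preproj_pi_scale k x :
  preproj_scale k (preproj_pi x) = preproj_pi (k *: x).
Proof.
apply/preproj_piP; rewrite -scalerBr -[X in _ *: X]mul1r scalerAl.
by rewrite preproj_idealMl ?preproj_pi_repr.
Qed.

Lemma preproj_ind (P : preprojective -> Prop) :
  (forall x, P (preproj_pi x)) -> forall u, P u.
Proof. by move=> h u; rewrite -[u]preproj_reprK. Qed.

Lemma preproj_mulA : associative preproj_mul.
Proof.
by elim/preproj_ind=> x; elim/preproj_ind=> y; elim/preproj_ind=> z;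
  rewrite !preproj_pi_mul mulrA.
Qed.

Lemma preproj_mul1 : left_id preproj_one preproj_mul.
Proof. by elim/preproj_ind=> x; rewrite preproj_pi_mul mul1r. Qed.

Lemma preproj_mulr1 : right_id preproj_one preproj_mul.
Proof. by elim/preproj_ind=> x; rewrite preproj_pi_mul mulr1. Qed.

Lemma preproj_mulDl : left_distributive preproj_mul +%R.
Proof.
by elim/preproj_ind=> x; elim/preproj_ind=> y; elim/preproj_ind=> z;
  rewrite -raddfD !preproj_pi_mul mulrDl raddfD.
Qed.

Lemma preproj_mulDr : right_distributive preproj_mul +%R.
Proof.
by elim/preproj_ind=> x; elim/preproj_ind=> y; elim/preproj_ind=> z;
  rewrite -raddfD !preproj_pi_mul mulrDr raddfD.
Qed.

Lemma preproj_one_neq0 : preproj_one != 0.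
Proof.
apply/eqP; rewrite -(raddf0 preproj_pi) => /preproj_piP.
by rewrite subr0 (negPf preproj_ideal1).
Qed.

HB.instance Definition _ := GRing.Zmodule_isNzRing.Build preprojective
  preproj_mulA preproj_mul1 preproj_mulr1 preproj_mulDl preproj_mulDr
  preproj_one_neq0.

Lemma preproj_scaleA a b v :
  preproj_scale a (preproj_scale b v) = preproj_scale (a * b) v.
Proof. by elim/preproj_ind: v => x; rewrite !preproj_pi_scale scalerA. Qed.

Lemma preproj_scale1 : left_id 1 preproj_scale.
Proof. by elim/preproj_ind=> x; rewrite preproj_pi_scale scale1r. Qed.

Lemma preproj_scaleDr : right_distributive preproj_scale +%R.
Proof.
move=> k; elim/preproj_ind=> x; elim/preproj_ind=> y.
by rewrite -raddfD !preproj_pi_scale scalerDr raddfD.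
Qed.

Lemma preproj_scaleDl v : {morph preproj_scale^~ v : a b / a + b}.
Proof.
elim/preproj_ind: v => x a b.
by rewrite !preproj_pi_scale scalerDl raddfD.
Qed.

HB.instance Definition _ := GRing.Zmodule_isLmodule.Build K preprojective
  preproj_scaleA preproj_scale1 preproj_scaleDr preproj_scaleDl.

Lemma preproj_scaleAl (k : K) (u v : preprojective) :
  k *: (u * v) = (k *: u) * v.
Proof.
elim/preproj_ind: u => x; elim/preproj_ind: v => y.
rewrite -[LHS]/(preproj_scale k (preproj_mul _ _)).
rewrite -[RHS]/(preproj_mul (preproj_scale k _) _).
by rewrite preproj_pi_mul !preproj_pi_scale preproj_pi_mul scalerAl.
Qed.

Lemma preproj_scaleAr (k : K) (u v : preprojective) :
  k *: (u * v) = u * (k *: v).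
Proof.
elim/preproj_ind: u => x; elim/preproj_ind: v => y.
rewrite -[LHS]/(preproj_scale k (preproj_mul _ _)).
rewrite -[RHS]/(preproj_mul _ (preproj_scale k _)).
by rewrite preproj_pi_mul !preproj_pi_scale preproj_pi_mul scalerAr.
Qed.

HB.instance Definition _ :=
  GRing.Lmodule_isLalgebra.Build K preprojective preproj_scaleAl.
HB.instance Definition _ :=
  GRing.Lalgebra_isAlgebra.Build K preprojective preproj_scaleAr.

End Preprojective.

(* Modules are left modules; duality over K makes the choice of side
   immaterial for representation-finiteness. *)
Section Modules.
Variables (K : fieldType) (A : algType K).

Definition fin_dim (M : lmodType A) : Prop :=
  exists (m : nat) (e : 'I_m -> M), forall x : M,
    exists c : 'I_m -> K, x = \sum_i (c i)%:A *: e i.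

Definition module_iso (M N : lmodType A) : Prop :=
  exists f : {linear M -> N}, bijective f.

Definition zero_module (M : lmodType A) : Prop := forall x : M, x = 0.

Definition indecomposable (M : lmodType A) : Prop :=
  ~ zero_module M /\
  forall M1 M2 : lmodType A,
    module_iso M (M1 * M2)%type -> zero_module M1 \/ zero_module M2.

Definition representation_finite : Prop :=
  exists (m : nat) (F : 'I_m -> lmodType A),
    forall M : lmodType A, fin_dim M -> indecomposable M ->
      exists i : 'I_m, module_iso M (F i).

End Modules.

(* Main.v *)
From HB Require Import structures.
Require Import Defs.
From mathcomp Require Import all_boot all_order all_fingroup all_algebra all_field.
From mathcomp Require Import ring zify.
From mathcomp Require Import boolp.

Set Implicit Arguments.
Unset Strict Implicit.
Unset Printing Implicit Defensive.

Import Order.TTheory GRing.Theory Num.Theory.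

Local Open Scope ring_scope.

(** Among the Dynkin diagrams, both properties single out A1, A2, A3, A4.

    Every other diagram contains A5 (type A) or the star D4 (types D and E) as
    a full subdiagram.  Over the preprojective algebra of each of these two
    there is a family of indecomposable modules, pairwise non-isomorphic,
    indexed by the infinite field K; extended by zero it lives over the whole
    quiver, so finitely many classes cannot suffice (graph_family_infinite,
    D4_representation_infinite, A5_representation_infinite).  On the mutation
    side, at most two mutations inside the subdiagram lead to an exchange matrix
    B with an integer row x, supported on the subdiagram, such that
    |xB|^2 > 4 |x|^2.  As B is normal, this forces an eigenvalue of modulus
    larger than 2, and restricting B to the subdiagram only shortens xB, so that
    the small submatrix decides (spectral_radius_window, star_stretches,
    path_stretches).

    For at most four vertices on a line, the labelled mutation class is a finite
    list of skew 4 x 4 matrices.  Such a matrix satisfies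
    B^4 + S B^2 + P^2 = 0, where S is the sum of the squares of the entries
    above the diagonal and P is the Pfaffian; the whole list has S <= 4 and
    4 P^2 <= S^2, which confines the eigenvalues to modulus 2
    (mutation_class4P, eigenvalue_bound).

    It remains to show that the preprojective algebra of A4 is
    representation-finite.  A module amounts to spaces V0, V1, V2, V3 with maps
    in both directions between neighbours, subject to the relations.  The two
    ways from V1 to V1 give the same square-zero map phi, the two from V2 to V2
    the same map psi, and V0 is seen from V1 only through the flag

      im phi <= im (V0 -> V1) <= ker (V1 -> V0) <= ker phi;

    symmetrically for V3 and V2.  What is left is a representation of a cyclic
    quiver with two vertices, in which paths of length four vanish, together
    with two flags.  For each shape in a finite list, a failing inclusion
    between subspaces built from the flags, images and kernels produces vectors
    and linear forms that split off a summand of this shape (split_proj,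
    split_two, split_one, split_three, split_glued); if all the inclusions hold,
    the representation is zero (exists_summand).  Projecting onto a summand is
    idempotent, so an indecomposable module is its summand, and two
    indecomposable modules with a summand of the same shape are isomorphic
    (same_summand_iso). *)

(** * Generators of the preprojective algebra *)

Section Generators.
Variables (K : fieldType) (n : nat) (Q : quiver n.+1).
Local Notation DQ := (double_quiver Q).
Local Notation A := (preprojective K Q).
Local Notation pi := (@preproj_pi K n Q).

Definition vertex_elt (x : 'I_n.+1) : A := pi (path_elt K (trivial_path DQ x)).
Definition arrow_sum : A := \sum_(b : arrow DQ) pi (arrow_elt K b).

Lemma preproj_piM x y : pi (x * y) = pi x * pi y.
Proof. by rewrite -preproj_pi_mul. Qed.

Lemma preproj_piZ k x : pi (k *: x) = k *: pi x.
Proof. by rewrite -preproj_pi_scale. Qed.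

Lemma vertex_eltM x y :
  vertex_elt x * vertex_elt y = if x == y then vertex_elt x else 0.
Proof.
rewrite -preproj_piM [_ * _]path_mul_elt /basis_mul qpath_cat1p /qpath_source /=.
by case: eqP => [->|_] //=; rewrite raddf0.
Qed.

Lemma sum_vertex_elt : \sum_x vertex_elt x = 1.
Proof. by rewrite -[RHS]/(pi 1) [in RHS]/1 /= /path_one raddf_sum. Qed.

Lemma vertex_arrow x (b : arrow DQ) :
  vertex_elt x * pi (arrow_elt K b) =
  if source b == x then pi (arrow_elt K b) else 0.
Proof.
rewrite -preproj_piM [_ * _]path_mul_elt /basis_mul qpath_cat1p [_ == _]eq_sym.
by rewrite /qpath_source /=; case: ifP => //= _; rewrite raddf0.
Qed.

Lemma arrow_vertex x (b : arrow DQ) :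
  pi (arrow_elt K b) * vertex_elt x =
  if target b == x then pi (arrow_elt K b) else 0.
Proof.
rewrite -preproj_piM [_ * _]path_mul_elt /basis_mul qpath_catp1 [_ == _]eq_sym.
by rewrite /qpath_target /=; case: ifP => //= _; rewrite raddf0.
Qed.

Lemma corner_arrow_sum x y : vertex_elt x * arrow_sum * vertex_elt y =
  \sum_(b : arrow DQ | (source b == x) && (target b == y)) pi (arrow_elt K b).
Proof.
rewrite mulr_sumr mulr_suml [RHS]big_mkcond /=; apply: eq_bigr => b _.
by rewrite vertex_arrow; case: ifP => _; rewrite ?mul0r // arrow_vertex.
Qed.

Variable adj : rel 'I_n.+1.
Hypothesis adjP : forall x y,
  #|[set b : arrow DQ | (source b == x) && (target b == y)]| = adj x y.

Lemma adj_arrow (b : arrow DQ) : adj (source b) (target b).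
Proof.
move: (adjP (source b) (target b)); case: adj => // /eqP.
by rewrite cards_eq0 => /eqP/setP/(_ b); rewrite !inE !eqxx.
Qed.

Lemma corner_arrow (b : arrow DQ) :
  vertex_elt (source b) * arrow_sum * vertex_elt (target b) = pi (arrow_elt K b).
Proof.
rewrite corner_arrow_sum (bigD1 b) ?eqxx //= big1 ?addr0 // => b' /andP[h ne].
have := adjP (source b) (target b); rewrite (adj_arrow b) => /eqP/cards1P[c hc].
move: (hc) => /setP/(_ b); rewrite !inE !eqxx => /esym/eqP e.
move: hc => /setP/(_ b'); rewrite !inE h => /esym/eqP e'.
by rewrite e' -e eqxx in ne.
Qed.

Lemma corner_nonadj x y : ~~ adj x y -> vertex_elt x * arrow_sum * vertex_elt y = 0.
Proof.
move=> nadj; rewrite corner_arrow_sum big1 // => b /andP[/eqP e1 /eqP e2].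
by move: nadj; rewrite -e1 -e2 adj_arrow.
Qed.

Lemma pi_relation i : pi (preproj_relation K Q i) = 0.
Proof.
rewrite -(raddf0 pi); apply/preproj_piP; rewrite subr0; apply/preproj_idealP.
by exists [:: (1, i, 1)]; rewrite big_seq1 /= mul1r mulr1.
Qed.

Lemma sigma_source (b : arrow DQ) : source (sigma b) = target b.
Proof. by case: b. Qed.
Lemma sigma_target (b : arrow DQ) : target (sigma b) = source b.
Proof. by case: b. Qed.

(** With simple edges, the only way back along an arrow b is its reverse, so
    that the defining relation at i says that the paths of length two from i to
    i add up to zero. *)
Lemma corner_square i : vertex_elt i * arrow_sum * arrow_sum * vertex_elt i = 0.
Proof.
rewrite -(pi_relation i) raddf_sum /= -[LHS]mulrA mulr_suml mulr_sumr.
rewrite [RHS]big_mkcond /=; apply: eq_bigr => b _.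
rewrite arrow_vertex; case: ifP => [/eqP tb|_]; last by rewrite mulr0.
rewrite preproj_piM -(corner_arrow (sigma b)) sigma_source sigma_target tb.
rewrite -[RHS]mulrA vertex_arrow.
by rewrite eqxx.
Qed.

Lemma path_elt_word i (s : seq (arrow DQ)) (w : walk i s) :
  pi (path_elt K (@QPath _ DQ (i, s) w)) =
  vertex_elt i * \prod_(a <- s) pi (arrow_elt K a).
Proof.
elim/last_ind: s w => [|s a IH] w.
  by rewrite big_nil mulr1; congr (pi (path_elt K _)); apply: val_inj.
have ws : walk i s by move: w; rewrite -cats1 walk_cat => /andP[].
have e : qpath_cat (@QPath _ DQ (i, s) ws) (arrow_path a) =
    Some (@QPath _ DQ (i, rcons s a) w).
  apply/qpath_catP; rewrite /= cats1; split=> //.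
  move: w; rewrite -cats1 walk_cat => /andP[_] /= /andP[/eqP].
  by rewrite /qpath_target /qpath_source /= => ->.
rewrite -[in RHS]cats1 big_cat big_seq1 /= mulrA -(IH ws) -preproj_piM [_ * _]path_mul_elt.
by rewrite /basis_mul e.
Qed.

(** The vertices and the sum of the arrows generate the algebra, because the
    arrow from x to y, being the only one, is the corner of that sum at (x, y). *)
Lemma preproj_gen_ind (S : A -> Prop) :
  S 1 -> (forall k u v, S u -> S v -> S (k *: u + v)) ->
  (forall x u, S u -> S (vertex_elt x * u)) ->
  (forall u, S u -> S (arrow_sum * u)) -> forall u, S u.
Proof.
move=> S1 Slin Sv Sc.
have S0 : S 0 by have := Slin (-1) _ _ S1 S1; rewrite scaleN1r addNr.
have Sword s : S (\prod_(a <- s) pi (@arrow_elt K _ DQ a)).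
  elim: s => [|a s IH]; first by rewrite big_nil.
  by rewrite big_cons -corner_arrow -!mulrA; apply/Sv/Sc/Sv.
elim/preproj_ind => x; rewrite [x]path_algebra_sumE raddf_sum /=.
apply: (big_rec S) => // -[[i s] w] u _ Su; rewrite preproj_piZ path_elt_word.
by apply: Slin => //; apply: Sv.
Qed.

End Generators.

Section ModuleMaps.
Variables (K : fieldType) (n : nat) (Q : quiver n.+1).
Local Notation A := (preprojective K Q).
Variable adj : rel 'I_n.+1.
Hypothesis adjP : forall x y,
  #|[set b : arrow (double_quiver Q) | (source b == x) && (target b == y)]| = adj x y.

Lemma scale_algE (B : algType K) (M : lmodType B) k (u : B) (x : M) :
  (k *: u) *: x = k%:A *: (u *: x).
Proof. by rewrite scalerA -scalerAl mul1r. Qed.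

Lemma preproj_linear (M N : lmodType A) (f : M -> N) :
  {morph f : x y / x + y} -> (forall k x, f (k%:A *: x) = k%:A *: f x) ->
  (forall i x, f (vertex_elt K Q i *: x) = vertex_elt K Q i *: f x) ->
  (forall x, f (arrow_sum K Q *: x) = arrow_sum K Q *: f x) -> linear f.
Proof.
move=> fD fZ fv fc u x y; rewrite fD; congr (_ + _).
elim/(preproj_gen_ind (K := K) adjP): u x => [x|k u v IHu IHv x|i u IH x|u IH x].
- by rewrite !scale1r.
- rewrite (scalerDl x) (scalerDl (f x)) fD IHv; congr (_ + _).
  by rewrite (scale_algE k u x) (scale_algE k u (f x)) fZ IHu.
- by rewrite -!scalerA fv IH.
- by rewrite -!scalerA fc IH.
Qed.

End ModuleMaps.

(** * Modules given by one square matrix *)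

Section GraphModule.
Variables (K : fieldType) (n : nat) (Q : quiver n.+1).
Local Notation DQ := (double_quiver Q).
Local Notation A := (preprojective K Q).
Variable adj : rel 'I_n.+1.
Hypothesis adjP : forall x y,
  #|[set b : arrow DQ | (source b == x) && (target b == y)]| = adj x y.
Variables (d : nat) (pos : 'I_d -> 'I_n.+1) (C : 'M[K]_d).
Hypothesis C_adj : forall k l, C k l != 0 -> adj (pos k) (pos l).
Hypothesis C_sq : forall k l, pos k = pos l -> (C *m C) k l = 0.

Definition vertex_mx (x : 'I_n.+1) : 'M[K]_d :=
  \matrix_(k, l) ((k == l) && (pos k == x))%:R.

Lemma vertex_mulmx x m (B : 'M_(d, m)) k l :
  (vertex_mx x *m B) k l = (pos k == x)%:R * B k l.
Proof.
rewrite !mxE (bigD1 k) //= !mxE eqxx big1 ?addr0 // => i ne.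
by rewrite !mxE [k == i]eq_sym (negPf ne) mul0r.
Qed.

Lemma mulmx_vertex x m (B : 'M_(m, d)) k l :
  (B *m vertex_mx x) k l = B k l * (pos l == x)%:R.
Proof.
rewrite !mxE (bigD1 l) //= !mxE eqxx big1 ?addr0 // => i ne.
by rewrite !mxE (negPf ne) mulr0.
Qed.

Definition arrow_mx (b : arrow DQ) : 'M[K]_d :=
  vertex_mx (source b) *m C *m vertex_mx (target b).

Lemma vertex_mx_mul x y :
  vertex_mx x *m vertex_mx y = if x == y then vertex_mx x else 0.
Proof.
apply/matrixP => k l; rewrite vertex_mulmx !mxE.
case: (x =P y) => [<-|ne]; rewrite !mxE -?natrM; last first.
  by case: (pos k =P x) => [->|_]; rewrite ?mul0n // mul1n (introF eqP ne) andbF.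
by case: eqP; rewrite ?mul0n ?mul1n ?andbF.
Qed.

Lemma vertex_mxK x m (B : 'M_(d, m)) : vertex_mx x *m (vertex_mx x *m B) = vertex_mx x *m B.
Proof. by rewrite mulmxA vertex_mx_mul eqxx. Qed.

Lemma sum_vertex_mx : \sum_x vertex_mx x = 1%:M.
Proof.
apply/matrixP => k l; rewrite summxE (bigD1 (pos k)) //= !mxE eqxx andbT.
by rewrite big1 ?addr0 // => x ne; rewrite mxE [_ == x]eq_sym (negPf ne) andbF.
Qed.

Definition word_mx (s : seq (arrow DQ)) : 'M[K]_d :=
  foldr (fun a B => arrow_mx a *m B) 1%:M s.
Definition path_mx (p : qpath DQ) : 'M[K]_d :=
  vertex_mx (val p).1 *m word_mx (val p).2.
Definition rep_mx (x : path_algebra K DQ) : 'M[K]_d := lin_ext path_mx x.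
HB.instance Definition _ := GRing.Linear.copy rep_mx (lin_ext path_mx).

Lemma word_mx_cat s t : word_mx (s ++ t) = word_mx s *m word_mx t.
Proof. by elim: s => [|a s IH] /=; rewrite ?mul1mx // IH mulmxA. Qed.

Lemma word_mx_last i s : walk i s -> vertex_mx i *m word_mx s =
  vertex_mx i *m word_mx s *m vertex_mx (last i (map (@target _ DQ) s)).
Proof.
elim: s i => [|a s IH] i /=; first by rewrite mulmx1 vertex_mx_mul eqxx.
case/andP => _ /IH e; rewrite /arrow_mx -!mulmxA [in LHS]e !mulmxA.
by rewrite -!mulmxA.
Qed.

Lemma path_mxM p q : rep_mx (basis_mul K p q) = path_mx p *m path_mx q.
Proof.
rewrite /path_mx word_mx_last ?(valP p) // -!mulmxA (mulmxA (vertex_mx _) (vertex_mx _)).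
rewrite vertex_mx_mul /basis_mul; case e: (qpath_cat p q) => [r|] /=; last first.
  have ne : qpath_target p <> qpath_source q.
    by move: e; rewrite /qpath_cat; case: eqP.
  rewrite (introF eqP ne : (last _ _ == _) = false).
  by rewrite mul0mx !mulmx0; exact: raddf0.
have [/eqP] := (qpath_catP _ _ _).1 e; rewrite /qpath_target /qpath_source => -> er.
rewrite [LHS]lin_ext_elt /path_mx er /= word_mx_cat.
by rewrite !mulmxA -word_mx_last ?(valP p).
Qed.

Lemma rep_mxM x y : rep_mx (path_mul x y) = rep_mx x *m rep_mx y.
Proof.
apply: (lin_extP (f := rep_mx \o path_rmul y) (g := mulmxr (rep_mx y) \o rep_mx)).
move=> p /=; rewrite [rep_mx (path_elt _ _)]lin_ext_elt.
apply: (lin_extP (f := rep_mx \o path_mul (path_elt K p))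
                 (g := mulmx (path_mx p) \o rep_mx)) => q /=.
by rewrite path_mul_elt path_mxM [rep_mx (path_elt _ _)]lin_ext_elt.
Qed.

Lemma rep_mx_vertex x : rep_mx (path_elt K (trivial_path DQ x)) = vertex_mx x.
Proof. by rewrite [LHS]lin_ext_elt /path_mx /= mulmx1. Qed.

Lemma rep_mx1 : rep_mx 1 = 1%:M.
Proof.
rewrite -sum_vertex_mx [1]/(path_one K DQ) /path_one raddf_sum /=.
by apply: eq_bigr => x _; rewrite rep_mx_vertex.
Qed.

Lemma rep_mx_arrow b : rep_mx (arrow_elt K b) = arrow_mx b.
Proof.
by rewrite [LHS]lin_ext_elt /path_mx /= mulmx1 /arrow_mx -!mulmxA vertex_mxK.
Qed.

Lemma sum_arrow_mx : \sum_b arrow_mx b = C.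
Proof.
apply/matrixP => k l; rewrite summxE.
under eq_bigr => b _ do
  rewrite mulmx_vertex vertex_mulmx mulrAC -natrM mulnb [pos k == _]eq_sym [pos l == _]eq_sym.
rewrite -mulr_suml -natr_sum.
set m := (X in X%:R); have -> : m = adj (pos k) (pos l).
  rewrite -adjP -sum1_card [RHS]big_mkcond; apply: eq_bigr => b _.
  by rewrite inE; case: ifP.
case: (boolP (adj _ _)) => [_|nadj]; first by rewrite mul1r.
by rewrite mul0r; apply/esym/eqP; apply: contraNT nadj => /C_adj.
Qed.

Lemma arrow_mx_vertex b x :
  arrow_mx b *m vertex_mx x = if target b == x then arrow_mx b else 0.
Proof.
by rewrite -mulmxA vertex_mx_mul; case: ifP => _; rewrite ?mulmx0.
Qed.

(** The images of the arrows being corners of C, the relation at i becomes the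
    corner of C^2 at i. *)
Lemma rep_mx_relation i : rep_mx (preproj_relation K Q i) = 0.
Proof.
have E b : target b == i -> rep_mx (arrow_elt K (sigma b) * arrow_elt K b) =
    vertex_mx i *m C *m arrow_mx b.
  move=> /eqP tb; rewrite [LHS]rep_mxM !rep_mx_arrow [X in X *m _]/arrow_mx.
  rewrite sigma_source sigma_target tb -[LHS]mulmxA; congr (_ *m _).
  by rewrite -[RHS]mul1mx [in LHS]/arrow_mx !mulmxA vertex_mx_mul eqxx mul1mx.
rewrite raddf_sum /= (eq_bigr _ E) -mulmx_sumr big_mkcond /=.
under eq_bigr => b _ do rewrite -arrow_mx_vertex.
rewrite -mulmx_suml sum_arrow_mx; apply/matrixP => k l.
rewrite -!mulmxA vertex_mulmx mulmxA mulmx_vertex [RHS]mxE.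
case: eqP => [ek|_]; last by rewrite mul0r.
by case: eqP => [el|_]; rewrite ?mulr0 // C_sq ?mul0r ?mulr0 // ek el.
Qed.

Lemma rep_mx_ideal x : x \in @preproj_ideal K n Q -> rep_mx x = 0.
Proof.
case/preproj_idealP => s ->; rewrite raddf_sum /= big1 // => t _.
by rewrite [LHS]rep_mxM [X in X *m _]rep_mxM rep_mx_relation mulmx0 mul0mx.
Qed.

Definition preproj_mx (u : A) : 'M[K]_d := rep_mx (preproj_repr u).

Lemma preproj_mx_pi x : preproj_mx (preproj_pi x) = rep_mx x.
Proof.
apply/subr0_eq; rewrite -(raddfB rep_mx) /=; apply: rep_mx_ideal.
exact: preproj_pi_repr.
Qed.

(** The space of columns, with an arrow from x to y acting as the corner of C
    at (x, y).  The hypotheses on C are arguments so that the action, which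
    needs them, is determined by the type. *)
Definition graph_module : Type := let _ := (adjP, C_adj, C_sq) in 'cV[K]_d.

HB.instance Definition _ := GRing.Zmodule.copy graph_module 'cV[K]_d.

Definition graph_scale (u : A) (v : graph_module) : graph_module :=
  preproj_mx u *m (v : 'cV_d).

Lemma graph_scaleA u u' v :
  graph_scale u (graph_scale u' v) = graph_scale (u * u') v.
Proof.
rewrite /graph_scale; elim/preproj_ind: u => x; elim/preproj_ind: u' => y.
by rewrite -preproj_piM !preproj_mx_pi [rep_mx (x * y)]rep_mxM mulmxA.
Qed.

Lemma graph_scale1 : left_id 1 graph_scale.
Proof.
by move=> v; rewrite /graph_scale -[1]/(preproj_pi 1) preproj_mx_pi rep_mx1 mul1mx.
Qed.

Lemma graph_scaleDr : right_distributive graph_scale +%R.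
Proof. by move=> u v w; rewrite /graph_scale [LHS]mulmxDr. Qed.

Lemma graph_scaleDl v : {morph graph_scale^~ v : u u' / u + u'}.
Proof.
elim/preproj_ind=> x; elim/preproj_ind=> y.
by rewrite -raddfD /graph_scale !preproj_mx_pi [rep_mx _]raddfD [LHS]mulmxDl.
Qed.

HB.instance Definition _ := GRing.Zmodule_isLmodule.Build A graph_module
  graph_scaleA graph_scale1 graph_scaleDr graph_scaleDl.

Lemma graph_algE k (v : graph_module) : k%:A *: v = k *: (v : 'cV_d) :> 'cV_d.
Proof.
rewrite -[LHS]/(preproj_mx (preproj_scale k (preproj_pi 1)) *m (v : 'cV_d)).
rewrite preproj_pi_scale preproj_mx_pi -[rep_mx _]/(lin_ext _ _) linearZ /=.
by rewrite -[lin_ext _ _]/(rep_mx 1) rep_mx1 -scalemxAl mul1mx.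
Qed.

Lemma graph_vertexE x (v : graph_module) :
  vertex_elt K Q x *: v = vertex_mx x *m (v : 'cV_d) :> 'cV_d.
Proof.
rewrite -[LHS]/(preproj_mx _ *m (v : 'cV_d)).
by rewrite preproj_mx_pi rep_mx_vertex.
Qed.

Lemma graph_arrowE (v : graph_module) :
  arrow_sum K Q *: v = C *m (v : 'cV_d) :> 'cV_d.
Proof.
rewrite -[LHS]/(preproj_mx _ *m (v : 'cV_d)) /arrow_sum -raddf_sum preproj_mx_pi.
rewrite raddf_sum /=; under eq_bigr => b _ do rewrite rep_mx_arrow.
by rewrite sum_arrow_mx.
Qed.

Lemma graph_fin_dim : fin_dim graph_module.
Proof.
exists d, (fun i => delta_mx i 0 : 'cV_d); move=> v.
exists (fun i => (v : 'cV_d) i 0); rewrite {1}[v : 'cV_d]matrix_sum_delta.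
by apply: eq_bigr => i _; rewrite big_ord1 -graph_algE.
Qed.

End GraphModule.

(** Expanding (F - a)^2 = 0 with F^2 = F gives (1 - 2a) F = - a^2, and one more
    multiplication by F gives a^2 F = a^2. *)
Lemma idem_scalar_nilpotent (K : fieldType) d (F N : 'M[K]_d.+1) a :
  F = a%:M + N -> N *m N = 0 -> F *m F = F -> F = 0 \/ F = 1.
Proof.
move=> FE NN FF.
have e : F - a *: F - a *: F + (a * a)%:M = 0.
  have -> : 0 = (F - a%:M) * (F - a%:M) by rewrite FE addrAC subrr add0r -mulmxE NN.
  rewrite mulrBl !mulrBr -!mulmxE FF mul_scalar_mx mul_mx_scalar -scalar_mxM.
  by rewrite -addrA opprB; congr (_ + _); rewrite addrC.
have e' : (a * a) *: F = (a * a)%:M.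
  have := congr1 (mulmx F) e; rewrite mulmx0 mulmxDr !mulmxBr FF -!scalemxAr FF.
  by rewrite -e mul_mx_scalar => /addrI.
have [a0|a0] := eqVneq a 0.
  by left; move: e; rewrite a0 scale0r !subr0 mul0r raddf0 addr0.
right; apply: (scalerI (mulf_neq0 a0 a0)).
by rewrite e' -scalemx1.
Qed.

(** An algebraically closed field is infinite: the product of the X - a, for a
    in a finite list, times X and plus 1, has a root outside the list. *)
Lemma exists_uniq_seq (K : closedFieldType) m : exists2 s : seq K, uniq s & size s = m.
Proof.
elim: m => [|m [s us ss]]; first by exists [::].
pose q : {poly K} := \prod_(a <- s) ('X - a%:P) * 'X + 1.
have /closed_rootP[b qb] : size q != 1.
  rewrite size_polyDl size_mulX ?monic_neq0 ?monic_prod_XsubC // size_prod_XsubC //.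
  by rewrite size_poly1.
exists (b :: s); last by rewrite /= ss.
rewrite /= us andbT; apply/negP => bs; move: qb.
rewrite /root hornerD hornerM hornerC.
have /eqP -> : (\prod_(a <- s) ('X - a%:P)).[b] == 0.
  by rewrite -[_ == 0]/(root _ b) root_prod_XsubC.
by rewrite mul0r add0r oner_eq0.
Qed.

Section GraphFamily.
Variables (K : closedFieldType) (n : nat) (Q : quiver n.+1).
Local Notation DQ := (double_quiver Q).
Local Notation A := (preprojective K Q).
Variable adj : rel 'I_n.+1.
Hypothesis adjP : forall x y,
  #|[set b : arrow DQ | (source b == x) && (target b == y)]| = adj x y.
Variables (d : nat) (pos : 'I_d.+1 -> 'I_n.+1) (C : K -> 'M[K]_d.+1).
Hypothesis C_adj : forall t k l, C t k l != 0 -> adj (pos k) (pos l).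
Hypothesis C_sq : forall t k l, pos k = pos l -> (C t *m C t) k l = 0.
Hypothesis C_hom : forall t t' (F : 'M[K]_d.+1),
  (forall k l, pos k != pos l -> F k l = 0) -> F *m C t = C t' *m F ->
  exists a N, [/\ F = a%:M + N, N *m N = 0 & a * (t - t') = 0].

Local Notation M t := (graph_module adjP (@C_adj t) (@C_sq t)).

Lemma graph_hom t t' (f : {linear M t -> M t'}) :
  exists F : 'M_d.+1, [/\ forall v, f v = F *m (v : 'cV_d.+1),
    forall k l, pos k != pos l -> F k l = 0 & F *m C t = C t' *m F].
Proof.
pose g (v : 'cV[K]_d.+1) : 'cV[K]_d.+1 := f v.
have gZ k v : g (k *: v) = k *: g v.
  by have := linearZ_LR f (k%:A) (v : M t); rewrite !graph_algE.
have gD u v : g (u + v) = g u + g v by rewrite /g raddfD.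
pose F : 'M[K]_d.+1 := \matrix_(k, l) g (delta_mx l 0) k 0.
have gE v : g v = F *m v.
  have g0 : g 0 = 0 by exact: (raddf0 f).
  rewrite {1}[v]matrix_sum_delta (big_morph g gD g0).
  apply/matrixP => k j; rewrite ord1 summxE !mxE; apply: eq_bigr => l _.
  by rewrite big_ord1 gZ !mxE mulrC.
have E (B B' : 'M[K]_d.+1) : (forall v : 'cV_d.+1, B *m v = B' *m v) -> B = B'.
  move=> e; apply/matrixP => k l; have /matrixP/(_ k 0) := e (delta_mx l 0).
  by rewrite -!colE !mxE.
exists F; split=> //.
- move=> k l ne.
  have : F *m vertex_mx K pos (pos l) = vertex_mx K pos (pos l) *m F.
    apply: E => v; rewrite -!mulmxA -!gE.
    have := linearZ_LR f (vertex_elt K Q (pos l)) (v : M t).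
    by rewrite !graph_vertexE.
  move/matrixP/(_ k l); rewrite mulmx_vertex vertex_mulmx eqxx mulr1.
  by rewrite (negPf ne) mul0r.
- apply: E => v; rewrite -!mulmxA -!gE.
  have := linearZ_LR f (arrow_sum K Q) (v : M t).
  by rewrite !graph_arrowE.
Qed.

(** A direct sum decomposition gives an idempotent endomorphism, which is 0 or 1
    since endomorphisms are scalars plus a square-zero matrix. *)
Lemma graph_indecomposable t : indecomposable (M t).
Proof.
split.
  move=> /(_ (const_mx 1 : 'cV[K]_d.+1))/matrixP/(_ 0 0)/eqP.
  by rewrite !mxE oner_eq0.
move=> M1 M2 [f [g fK gK]].
have gl : linear g by apply: (can2_linear fK gK).
pose p (u : M t) : M t := g ((f u).1, 0).
have p_lin : linear p.
  move=> k u v; rewrite /p linearP /= -gl; congr g.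
  by rewrite -[RHS]/(_, _) /= scaler0 addr0.
pose P : {linear M t -> M t} := HB.pack p (GRing.isLinear.Build _ _ _ _ p p_lin).
have [F [PE Fpos FC]] := graph_hom P.
have [a [N [FE NN _]]] := C_hom Fpos FC.
have pp u : p (p u) = p u by rewrite /p gK.
have FF : F *m F = F.
  apply/matrixP => k l; have := pp (delta_mx l 0 : 'cV_d.+1).
  rewrite -[p]/(P : _ -> _) !PE mulmxA => /matrixP/(_ k 0).
  by rewrite -!colE !mxE.
have [F0|F1] := idem_scalar_nilpotent FE NN FF.
- left=> x; have : P (g (x, 0)) = 0 by rewrite PE F0 mul0mx.
  rewrite /= /p gK /= => /(congr1 f); rewrite gK raddf0.
  by case.
- right=> y; have : P (g (0, y)) = g (0, y) by rewrite PE F1 mul1mx.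
  rewrite /= /p gK /= => /(congr1 f); rewrite !gK.
  by case.
Qed.

(** A map between different members has square zero as a matrix, hence is not
    injective. *)
Lemma graph_iso_inj t t' : module_iso (M t) (M t') -> t = t'.
Proof.
case=> f /bij_inj f_inj; have [F [fE Fpos FC]] := graph_hom f.
have [a [N [FE NN /eqP]]] := C_hom Fpos FC.
rewrite mulf_eq0 subr_eq0 => /orP[/eqP a0|/eqP //].
have F0 : F *m F = 0 by rewrite FE a0 raddf0 add0r.
have F_inj (v : 'cV[K]_d.+1) : F *m v = 0 -> v = 0.
  by rewrite -[F *m v]fE -[RHS](raddf0 f) => /f_inj.
have /F_inj/F_inj/matrixP/(_ 0 0)/eqP : F *m (F *m (const_mx 1 : 'cV_d.+1)) = 0.
  by rewrite mulmxA F0 mul0mx.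
by rewrite !mxE oner_eq0.
Qed.

Lemma module_iso_sym (B : algType K) (X Y : lmodType B) :
  module_iso X Y -> module_iso Y X.
Proof.
case=> f [g fK gK]; have gl : linear g by apply: (can2_linear fK gK).
pose G : {linear Y -> X} := HB.pack g (GRing.isLinear.Build _ _ _ _ g gl).
by exists G, f.
Qed.

Lemma module_iso_trans (B : algType K) (X Y Z : lmodType B) :
  module_iso X Y -> module_iso Y Z -> module_iso X Z.
Proof. by case=> f bf [g bg]; exists (g \o f); apply: bij_comp. Qed.

(** Pigeonhole: among more parameters than representatives, two members would
    be isomorphic to the same representative, hence to each other. *)
Theorem graph_family_infinite : ~ representation_finite A.
Proof.
case=> m [F FP].
have [s us ss] := exists_uniq_seq K m.+1.
have FPt t : exists i, module_iso (M t) (F i).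
  by apply: FP; [exact: graph_fin_dim | exact: graph_indecomposable].
pose i t := sval (cid (FPt t)).
have /injectivePn[j [k jk]] :
    ~~ injectiveb (fun j : 'I_m.+1 => i (tnth (Tuple (introT eqP ss)) j)).
  apply/negP => /injectiveP /leq_card; by rewrite !card_ord ltnn.
rewrite !(tnth_nth 0) /= => e; case/eqP: jk; apply: val_inj => /=.
apply/eqP; rewrite -(nth_uniq 0 _ _ us) ?ss //; apply/eqP; apply: graph_iso_inj.
have isoP t : module_iso (M t) (F (i t)) by exact: svalP (cid (FPt t)).
apply: module_iso_trans (isoP _) _; rewrite e.
exact: module_iso_sym.
Qed.

End GraphFamily.

(** * One-parameter families over D4 and A5 *)

Definition table_mx (K : fieldType) d (c : seq (seq K)) : 'M[K]_d :=
  \matrix_(k, l) nth 0 (nth [::] c k) l.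

Lemma table_mulmx (K : fieldType) d (F : 'M[K]_d.+1) c i j : (j < d.+1)%N ->
  (F *m table_mx d.+1 c) (inord i) (inord j) =
  \sum_(0 <= m < d.+1) F (inord i) (inord m) * nth 0 (nth [::] c m) j.
Proof.
move=> jd; rewrite mxE big_mkord; apply: eq_bigr => m _.
by rewrite mxE inordK // inord_val.
Qed.

Lemma mulmx_table (K : fieldType) d (F : 'M[K]_d.+1) c i j : (i < d.+1)%N ->
  (table_mx d.+1 c *m F) (inord i) (inord j) =
  \sum_(0 <= m < d.+1) nth 0 (nth [::] c i) m * F (inord m) (inord j).
Proof.
move=> id; rewrite mxE big_mkord; apply: eq_bigr => m _.
by rewrite mxE inordK // inord_val.
Qed.

(** N maps the tops T into the socles B and kills everything else, socles
    included. *)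
Lemma scalar_plus_square_zero (K : fieldType) d (F : 'M[K]_d.+1) (a : K)
    (T B : pred nat) : (forall i, T i -> ~~ B i) ->
  (forall i j, (i < d.+1)%N -> (j < d.+1)%N ->
     F (inord i) (inord j) =
       if i == j then a else if T j && B i then F (inord i) (inord j) else 0) ->
  exists2 N, F = a%:M + N & N *m N = 0.
Proof.
move=> TB FE; exists (F - a%:M); first by rewrite addrC subrK.
have NE (k l : 'I_d.+1) : ~~ (T l && B k) -> (F - a%:M) k l = 0.
  move=> h; rewrite !mxE -(inord_val k) -(inord_val l) FE //.
  rewrite !inord_val (negPf h) -val_eqE /=.
  by case: eqP => _; rewrite ?mulr1n ?mulr0n subrr.
apply/matrixP => k l; rewrite !mxE big1 // => m _.
case: (boolP (T m && B k)) => [/andP[/TB Bm _]|/NE ->]; last by rewrite mul0r.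
by rewrite [X in _ * X]NE ?mulr0 // (negPf Bm) andbF.
Qed.

Lemma corner_entry (K : fieldType) d (p : nat -> nat) (F : 'M[K]_d.+1) :
  (forall k l : 'I_d.+1, p k != p l -> F k l = 0) ->
  forall i j, (i < d.+1)%N -> (j < d.+1)%N -> F (inord i) (inord j) =
    if p i == p j then F (inord i) (inord j) else 0.
Proof.
by move=> Fp i j id jd; case: eqP => // /eqP ne; rewrite Fp // !inordK.
Qed.

(** The intertwining equations, entry by entry and with natural number indices,
    so that the sums compute on concrete tables. *)
Lemma table_hom (K : fieldType) d (p : nat -> nat) c c' (F : 'M[K]_d.+1) :
  (forall k l : 'I_d.+1, p k != p l -> F k l = 0) ->
  F *m table_mx d.+1 c = table_mx d.+1 c' *m F ->
  let f i j := if p i == p j then F (inord i) (inord j) else 0 in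
  forall i j, (i < d.+1)%N -> (j < d.+1)%N ->
    \sum_(0 <= m < d.+1) f i m * nth 0 (nth [::] c m) j =
    \sum_(0 <= m < d.+1) nth 0 (nth [::] c' i) m * f m j.
Proof.
move=> Fp FC f i j id jd.
have := congr1 (fun B : 'M__ => B (inord i) (inord j)) FC.
rewrite table_mulmx // mulmx_table // => e; apply: etrans (etrans _ e) _.
  by rewrite !big_mkord; apply: eq_bigr => m _; rewrite /f [in RHS](corner_entry Fp).
by rewrite !big_mkord; apply: eq_bigr => m _; rewrite /f [in LHS](corner_entry Fp).
Qed.

Section D4.
Variable K : fieldType.

(* Basis: top and socle at the centre (0 and 4), one vector on each leaf. *)
Definition D4_pos (i : nat) : nat := nth 0%N [:: 0; 1; 2; 3; 0]%N i.
(** The top reaches the three leaves with coefficients 1, t, - 1 - t, whose sum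
    is zero as the relation at the centre demands; each leaf reaches the socle
    with coefficient 1.  Rescaling the basis cannot change the ratios of the
    three products. *)
Definition D4_table (t : K) : seq (seq K) :=
  [:: [::]; [:: 1]; [:: t]; [:: - 1 - t]; [:: 0; 1; 1; 1]].
Definition D4_mx t : 'M[K]_5 := table_mx 5 (D4_table t).

Lemma D4_adj t (k l : 'I_5) : D4_mx t k l != 0 ->
  (D4_pos k == 0%N) != (D4_pos l == 0%N).
Proof.
rewrite mxE; case: k l => [[|[|[|[|[|k]]]]] //= _] [[|[|[|[|[|l]]]]] //= _];
  by rewrite ?eqxx.
Qed.

Lemma D4_sq t (k l : 'I_5) : (D4_mx t *m D4_mx t) k l = 0.
Proof.
rewrite -(inord_val k) -(inord_val l) table_mulmx // unlock /=.
rewrite !mxE !inordK //.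
case: k l => [[|[|[|[|[|k]]]]] //= _] [[|[|[|[|[|l]]]]] //= _]; ring.
Qed.

Lemma D4_hom t t' (F : 'M[K]_5) :
  (forall k l : 'I_5, D4_pos k != D4_pos l -> F k l = 0) ->
  F *m D4_mx t = D4_mx t' *m F ->
  exists a N, [/\ F = a%:M + N, N *m N = 0 & a * (t - t') = 0].
Proof.
move=> Fpos FC.
have H := table_hom Fpos FC.
have h10 := H 1%N 0%N isT isT; have h20 := H 2%N 0%N isT isT.
have h41 := H 4%N 1%N isT isT; have h42 := H 4%N 2%N isT isT.
have h43 := H 4%N 3%N isT isT; have h01 := H 0%N 1%N isT isT.
move: h10 h20 h41 h42 h43 h01.
rewrite unlock /= !(mulr0, mul0r, mulr1, mul1r, addr0, add0r).
move=> h10 h20 h41 h42 h43 h01.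
have [||N FN NN] := @scalar_plus_square_zero _ _ F (F (inord 0) (inord 0)) (pred1 0%N) (pred1 4%N).
- by move=> i /eqP ->.
- move=> i j hi hj; rewrite (corner_entry Fpos) //.
  by case: i j hi hj => [|[|[|[|[|i]]]]] [|[|[|[|[|j]]]]] //= _ _; congruence.
exists (F (inord 0) (inord 0)), N; split=> //.
by rewrite mulrBr [_ * t']mulrC -h20 -h42 h41 h10 subrr.
Qed.
End D4.

Section A5.
Variable K : fieldType.

(* Basis: tops 0, 1 and socles 6, 7 at the second and fourth vertices, a plane
   3, 4 at the middle, one vector at each end. *)
Definition A5_pos (i : nat) : nat := nth 0%N [:: 1; 3; 0; 2; 2; 4; 1; 3]%N i.
(** The tops single out two lines of the plane at the middle vertex, the
    kernels of the maps to the two socles single out two more, and t fixes the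
    cross-ratio of the four.  The end vertices cancel the way from a top to the
    socle at the same vertex that passes through the plane. *)
Definition A5_table (t : K) : seq (seq K) :=
  [:: [::]; [::]; [:: -1]; [:: 1]; [:: 0; 1]; [:: 0; - t];
      [:: 0; 0; 1; 1; 1]; [:: 0; 0; 0; 1; t; 1]].
Definition A5_mx t : 'M[K]_8 := table_mx 8 (A5_table t).

Lemma A5_adj t (k l : 'I_8) : A5_mx t k l != 0 ->
  (A5_pos k == (A5_pos l).+1) || (A5_pos l == (A5_pos k).+1).
Proof.
rewrite mxE; case: k l => [[|[|[|[|[|[|[|[|k]]]]]]]] //= _] [[|[|[|[|[|[|[|[|l]]]]]]]] //= _];
  by rewrite ?eqxx.
Qed.

Lemma A5_sq t (k l : 'I_8) : A5_pos k = A5_pos l -> (A5_mx t *m A5_mx t) k l = 0.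
Proof.
rewrite -[X in X = 0](congr2 (A5_mx t *m A5_mx t) (inord_val k) (inord_val l)).
rewrite table_mulmx // unlock /= !mxE !inordK //.
case: k l => [[|[|[|[|[|[|[|[|k]]]]]]]] //= _] [[|[|[|[|[|[|[|[|l]]]]]]]] //= _] //= _; ring.
Qed.

Lemma A5_hom t t' (F : 'M[K]_8) :
  (forall k l : 'I_8, A5_pos k != A5_pos l -> F k l = 0) ->
  F *m A5_mx t = A5_mx t' *m F ->
  exists a N, [/\ F = a%:M + N, N *m N = 0 & a * (t - t') = 0].
Proof.
move=> Fpos FC.
have H := table_hom Fpos FC.
have h20 := H 2%N 0%N isT isT; have h30 := H 3%N 0%N isT isT.
have h40 := H 4%N 0%N isT isT; have h31 := H 3%N 1%N isT isT.
have h41 := H 4%N 1%N isT isT; have h51 := H 5%N 1%N isT isT.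
have h02 := H 0%N 2%N isT isT; have h62 := H 6%N 2%N isT isT.
have h13 := H 1%N 3%N isT isT; have h73 := H 7%N 3%N isT isT.
have h64 := H 6%N 4%N isT isT; have h74 := H 7%N 4%N isT isT.
have h75 := H 7%N 5%N isT isT.
move: h20 h30 h40 h31 h41 h51 h02 h62 h13 h73 h64 h74 h75.
rewrite unlock /= !(mulr0, mul0r, mulr1, mul1r, addr0, add0r, mulrN1, mulN1r).
move=> /oppr_inj h20 h30 h40 h31 h41 h51 h02 h62 h13 h73 h64 h74 h75.
have [||N FN NN] := @scalar_plus_square_zero _ _ F (F (inord 0) (inord 0)) (pred2 0 1)%N (pred2 6 7)%N.
- by case=> [|[|i]].
- rewrite h40 mulr0 addr0 in h73; rewrite h31 add0r in h64.
  move=> i j hi hj; rewrite (corner_entry Fpos) //.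
  by case: i j hi hj => [|[|[|[|[|[|[|[|i]]]]]]]] [|[|[|[|[|[|[|[|j]]]]]]]] //= _ _; congruence.
exists (F (inord 0) (inord 0)), N; split=> //.
rewrite h31 add0r in h64; move: h74.
rewrite h31 h73 h40 mulr0 addr0 add0r -h64 h62 h20 h30.
by rewrite [t' * _]mulrC mulrBr => ->; rewrite subrr.
Qed.
End A5.

Section Subdiagram.
Variables (K : closedFieldType) (n : nat) (Q : quiver n.+1).
Variable adj : rel 'I_n.+1.
Hypothesis adjP : forall x y,
  #|[set b : arrow (double_quiver Q) | (source b == x) && (target b == y)]| = adj x y.
Hypothesis adj_sym : symmetric adj.
Variable i : nat -> 'I_n.+1.

Theorem D4_representation_infinite : {in gtn 4 &, injective i} ->
  (forall j, (0 < j < 4)%N -> adj (i 0%N) (i j)) ->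
  ~ representation_finite (preprojective K Q).
Proof.
move=> i_inj i_adj.
have posP (k : 'I_5) : (D4_pos k < 4)%N by case: k => [[|[|[|[|[|k]]]]] //= _].
apply: (@graph_family_infinite K n Q adj adjP 4 (fun k => i (D4_pos k)) (@D4_mx K)).
- move=> t k l /D4_adj; case: (D4_pos k) (posP k) (D4_pos l) (posP l) => [|x] hx [|y] hy // _.
    exact: i_adj.
  by rewrite adj_sym; exact: i_adj.
- by move=> t k l _; apply: D4_sq.
- move=> t t' F Fp; apply: D4_hom => k l ne; apply: Fp.
  by apply: contraNneq ne => /i_inj ->; rewrite ?inE ?posP.
Qed.

Theorem A5_representation_infinite : {in gtn 5 &, injective i} ->
  (forall j, (j < 4)%N -> adj (i j) (i j.+1)) ->
  ~ representation_finite (preprojective K Q).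
Proof.
move=> i_inj i_adj.
have posP (k : 'I_8) : (A5_pos k < 5)%N by case: k => [[|[|[|[|[|[|[|[|k]]]]]]]] //= _].
apply: (@graph_family_infinite K n Q adj adjP 7 (fun k => i (A5_pos k)) (@A5_mx K)).
- move=> t k l /A5_adj/orP[]/eqP e; have := posP k; have := posP l; rewrite e ltnS => h h'.
    by rewrite adj_sym; apply: i_adj.
  exact: i_adj.
- by move=> t k l e; apply: A5_sq; apply: i_inj e; rewrite inE /= posP.
- move=> t t' F Fp; apply: A5_hom => k l ne; apply: Fp.
  by apply: contraNneq ne => /i_inj ->; rewrite ?inE ?posP.
Qed.

End Subdiagram.

(** * Representations of the doubled A4 quiver *)

Section LinearForms.
Variable K : fieldType.

Lemma separating_form m d (U : 'M[K]_(m, d)) (v : 'rV_d) : ~~ (v <= U)%MS ->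
  exists l : 'cV_d, U *m l = 0 /\ v *m l = 1%:M.
Proof.
rewrite submxE; move: (cokermx U) (mulmx_coker U) => C UC /rV0Pn[j vj].
exists (((v *m C) 0 j)^-1 *: col j C).
rewrite -!scalemxAr colE !mulmxA UC mul0mx scaler0; split=> //.
rewrite -colE; apply/matrixP => i k; rewrite !ord1 [LHS]mxE [X in _ * X]mxE.
by rewrite mulVf // mxE.
Qed.

Lemma separating_form2 m m' d (U : 'M[K]_(m, d)) (W : 'M_(m', d)) (v : 'rV_d) :
  ~~ (v <= U + W)%MS ->
  exists l : 'cV_d, [/\ U *m l = 0, W *m l = 0 & v *m l = 1%:M].
Proof.
rewrite addsmxE => /separating_form[l []]; rewrite mul_col_mx => /eqP.
by rewrite col_mx_eq0 => /andP[/eqP ? /eqP ?] ?; exists l.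
Qed.

Lemma factor_form d d' p (X : 'M[K]_(d, d')) (l : 'M_(d, p)) :
  kermx X *m l = 0 -> exists w, X *m w = l.
Proof.
move=> kl; exists (pinvmx X *m l); apply/esym/subr0_eq.
rewrite mulmxA -{1}[l]mul1mx -mulmxBl.
have /submxP[D ->] : (1%:M - X *m pinvmx X <= kermx X)%MS.
  by apply/sub_kermxP; rewrite mulmxBl mul1mx mulmxKpV ?submx_refl ?subrr.
by rewrite -mulmxA kl mulmx0.
Qed.

(** Zassenhaus: by the modular law an element of the intersection of the terms
    (i, j) is a sum of elements of the intersections at (i - 1, j) and
    (i, j - 1), and so on down to index 0. *)
Lemma cap_flags p q d (F : nat -> 'M[K]_(p, d)) (G : nat -> 'M[K]_(q, d)) m :
  (forall i, (i < m)%N -> (F i <= F i.+1)%MS) ->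
  (forall i, (i < m)%N -> (G i <= G i.+1)%MS) ->
  (forall i j, (i < m)%N -> (j < m)%N ->
     (F i.+1 :&: G j.+1 <= F i + G j)%MS) ->
  (F m :&: G m <= F 0 + G 0)%MS.
Proof.
move=> Fmon Gmon FG.
suff H i j : (i <= m)%N -> (j <= m)%N -> (F i :&: G j <= F 0 + G 0)%MS by apply: H.
elim: i j => [|i IHi] j; first by move=> _ _; rewrite (submx_trans (capmxSl _ _)) ?addsmxSl.
elim: j => [|j IHj] im jm; first by rewrite (submx_trans (capmxSr _ _)) ?addsmxSr.
apply/rV_subP => x; rewrite sub_capmx => /andP[xF xG].
have : (x <= F i + G j)%MS by apply: submx_trans (FG _ _ im jm); rewrite sub_capmx xF.
case/sub_addsmxP => -[a b] /= xE.
have aF : (a *m F i <= F i)%MS by apply: submxMl.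
have bG : (b *m G j <= G j)%MS by apply: submxMl.
rewrite xE addmx_sub //.
  apply: submx_trans (IHi j.+1 (ltnW im) jm); rewrite sub_capmx aF /=.
  have -> : a *m F i = x - b *m G j by rewrite xE addrK.
  by rewrite addmx_sub // eqmx_opp (submx_trans bG) ?Gmon.
apply: submx_trans (IHj im (ltnW jm)); rewrite sub_capmx bG andbT.
have -> : b *m G j = x - a *m F i by rewrite xE addrC addKr.
by rewrite addmx_sub // eqmx_opp (submx_trans aF) ?Fmon.
Qed.

End LinearForms.

Section Rep4.
Variable K : fieldType.

(** Matrices act on row vectors from the right, so that X0 is a map from V1 to V0;
    coord_rep explains the sign by which relations differs from the
    preprojective relations. *)
Record rep4 := Rep4 {
  dim0 : nat; dim1 : nat; dim2 : nat; dim3 : nat;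
  X0 : 'M[K]_(dim1, dim0); Y0 : 'M[K]_(dim0, dim1);
  X1 : 'M[K]_(dim2, dim1); Y1 : 'M[K]_(dim1, dim2);
  X2 : 'M[K]_(dim3, dim2); Y2 : 'M[K]_(dim2, dim3) }.

Definition relations V := [/\ Y0 V *m X0 V = 0, X0 V *m Y0 V = Y1 V *m X1 V,
  X1 V *m Y1 V = Y2 V *m X2 V & X2 V *m Y2 V = 0].

Definition mirror V := Rep4 (Y2 V) (X2 V) (Y1 V) (X1 V) (Y0 V) (X0 V).

Lemma mirror_relations V : relations V -> relations (mirror V).
Proof. by case. Qed.

(** The families u and w are an inclusion of R and a retraction onto it; each
    row of u together with the matching column of w is a vector and a linear
    form. *)
Definition summand (R V : rep4) : Prop :=
  exists (u0 : 'M_(dim0 R, dim0 V)) (u1 : 'M_(dim1 R, dim1 V))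
         (u2 : 'M_(dim2 R, dim2 V)) (u3 : 'M_(dim3 R, dim3 V))
         (w0 : 'M_(dim0 V, dim0 R)) (w1 : 'M_(dim1 V, dim1 R))
         (w2 : 'M_(dim2 V, dim2 R)) (w3 : 'M_(dim3 V, dim3 R)),
  [/\ [/\ u0 *m w0 = 1%:M, u1 *m w1 = 1%:M, u2 *m w2 = 1%:M & u3 *m w3 = 1%:M],
      [/\ u1 *m X0 V = X0 R *m u0, u2 *m X1 V = X1 R *m u1 & u3 *m X2 V = X2 R *m u2],
      [/\ u0 *m Y0 V = Y0 R *m u1, u1 *m Y1 V = Y1 R *m u2 & u2 *m Y2 V = Y2 R *m u3],
      [/\ X0 V *m w0 = w1 *m X0 R, X1 V *m w1 = w2 *m X1 R & X2 V *m w2 = w3 *m X2 R] &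
      [/\ Y0 V *m w1 = w0 *m Y0 R, Y1 V *m w2 = w1 *m Y1 R & Y2 V *m w3 = w2 *m Y2 R]].

Lemma mirror_summand R V : summand R (mirror V) -> summand (mirror R) V.
Proof.
case: V => ? ? ? ? ? ? ? ? ? ? /=.
case=> u0 [u1 [u2 [u3 [w0 [w1 [w2 [w3 [[? ? ? ?] [? ? ?] [? ? ?] [? ? ?] [? ? ?]]]]]]]]].
by exists u3, u2, u1, u0, w3, w2, w1, w0; split; split.
Qed.

Section Flag.
Variables (d0 d1 : nat) (x : 'M[K]_(d1, d0)) (y : 'M[K]_(d0, d1)).
Hypothesis yx0 : y *m x = 0.

(** The four subspaces through which V1 sees its neighbour V0, where x and y are
    the maps from V1 to V0 and back. *)
Definition flag (i : nat) : 'M[K]_d1 :=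
  match i with
  | 0 => <<x *m y>>%MS | 1 => <<y>>%MS | 2 => kermx x | _ => kermx (x *m y)
  end%N.

Lemma flagS i : (flag i <= flag i.+1)%MS.
Proof.
case: i => [|[|[|i]]] //=; rewrite ?genmxE ?submxMl //.
  by apply/sub_kermxP; rewrite yx0.
by apply/sub_kermxP; rewrite mulmxA mulmx_ker mul0mx.
Qed.

Lemma flag_le i j : (i <= j)%N -> (flag i <= flag j)%MS.
Proof.
move=> /subnK <-; elim: (j - i)%N => [|k IH]; first by rewrite add0n.
by rewrite addSn (submx_trans IH) ?flagS.
Qed.

Lemma flag_square i : flag i *m (x *m y) = 0.
Proof.
apply/sub_kermxP; apply: (submx_trans (flag_le (leq_maxl i 3))).
by rewrite /flag; case: (maxn i 3) (leq_maxr i 3) => [|[|[|k]]].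
Qed.

Lemma flag_form p i (l : 'M_(d1, p)) : flag i *m l = 0 -> x *m y *m l = 0.
Proof.
have /submxP[D eD] : (x *m y <= flag i)%MS.
  by apply: submx_trans (flag_le (leq0n i)); rewrite genmxE.
by rewrite eD -mulmxA => ->; rewrite mulmx0.
Qed.

(** A basis vector of V1 has level i if it lies in term i + 1 of the flag while
    the dual form kills term i.  At level 0 it is the image of a vector of V0, at
    level 2 it has a nonzero image in V0, and at level 1 it does not meet V0.
    The next two definitions are the corresponding maps between the line and
    its part in V0. *)
Definition level_dim (i : nat) : nat := (i != 1%N).
Definition level_X i : 'M[K]_(1, level_dim i) := const_mx (i == 2)%:R.
Definition level_Y i : 'M[K]_(level_dim i, 1) := const_mx (i == 0)%:R.

(** Level by level: a preimage of v and the composite y l; nothing; the image of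
    v and an extension of l along x. *)
Lemma level_extend i (v : 'rV_d1) (l : 'cV_d1) : (i < 3)%N ->
  (v <= flag i.+1)%MS -> flag i *m l = 0 -> v *m l = 1%:M ->
  exists (u : 'M_(level_dim i, d0)) (w : 'M_(d0, level_dim i)),
    [/\ u *m w = 1%:M, v *m x = level_X i *m u, u *m y = level_Y i *m v,
        x *m w = l *m level_X i & y *m l = w *m level_Y i].
Proof.
move=> i3 vf fl vl.
have one1 : const_mx 1 = 1%:M :> 'M[K]_1.
  by apply/matrixP => j k; rewrite !ord1 !mxE.
have zero p q : const_mx 0%:R = 0 :> 'M[K]_(p, q).
  by apply/matrixP => j k; rewrite !mxE.
case: i i3 vf fl => [|[|[|i]]] // _ vf fl; rewrite /level_X /level_Y /=.
- move: vf; rewrite genmxE => /submxP[u uE]; exists u, (y *m l).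
  rewrite !one1 !zero !mulmx1 mul1mx mul0mx mulmx0; split=> //.
  + by rewrite mulmxA -uE.
  + by rewrite uE -mulmxA yx0 mulmx0.
  + by rewrite mulmxA; apply: (@flag_form _ 0).
- exists 0, 0; rewrite !zero !mul0mx !mulmx0; split=> //.
  + by apply/matrixP => - [].
  + by apply/sub_kermxP.
  + by have /submxP[D ->] : (y <= flag 1)%MS; rewrite ?genmxE // -mulmxA fl mulmx0.
- have [w wE] := factor_form fl; exists (v *m x), w.
  rewrite !one1 !zero mulmx1 mul1mx mulmx0 mul0mx; split=> //.
  + by rewrite -mulmxA wE.
  + by rewrite -mulmxA; apply/sub_kermxP.
  + have /submxP[D ->] : (y <= kermx x)%MS by apply/sub_kermxP.
    by rewrite -mulmxA fl mulmx0.
Qed.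

(** Only for levels 0 and 2 do both vectors meet V0.  Then u' w = 0 comes from
    the forms killing im phi, and u w' is made 0 by moving u along u'. *)
Lemma level_extend2 i j (v v' : 'rV_d1) (l l' : 'cV_d1) : (i < j < 3)%N ->
  (v <= flag i.+1)%MS -> (v' <= flag j.+1)%MS -> flag i *m l = 0 -> flag j *m l' = 0 ->
  v *m l = 1%:M -> v' *m l' = 1%:M -> v *m l' = 0 -> v' *m l = 0 ->
  let R := block_mx (level_X i) 0 0 (level_X j) in
  let S := block_mx (level_Y i) 0 0 (level_Y j) in
  exists (u : 'M_(level_dim i + level_dim j, d0)) (w : 'M_(d0, level_dim i + level_dim j)),
    [/\ u *m w = 1%:M, col_mx v v' *m x = R *m u, u *m y = S *m col_mx v v',
        x *m w = row_mx l l' *m R & y *m row_mx l l' = w *m S].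
Proof.
move=> /andP[ij j3] vf vf' fl fl' vl vl' vl0 vl0' R S.
have i3 : (i < 3)%N by apply: ltn_trans j3.
have [u [w [uw vx uy xw yl]]] := level_extend i3 vf fl vl.
have [u' [w' [uw' vx' uy' xw' yl']]] := level_extend j3 vf' fl' vl'.
have [u1 [uw1 vx1 uy1 cross]] : exists u1 : 'M_(level_dim i, d0),
    [/\ u1 *m w = 1%:M, v *m x = level_X i *m u1, u1 *m y = level_Y i *m v &
        u1 *m w' = 0 /\ u' *m w = 0].
  case: i j ij j3 i3 {fl fl' vf vf' R S} (fl) u w uw vx uy xw yl u' w' uw' vx' uy' xw' yl'
    => [|[|i]] [|[|[|j]]] // _ _ _ fl0 u w uw vx uy xw yl u' w' uw' vx' uy' xw' yl'.
  - by exists u; split=> //; rewrite [w']thinmx0 [u']flatmx0 mulmx0 mul0mx.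
  - have one1 : const_mx 1 = 1%:M :> 'M[K]_1 by apply/matrixP => a b; rewrite !ord1 !mxE.
    have zero p q : const_mx 0%:R = 0 :> 'M[K]_(p, q) by apply/matrixP => a b; rewrite !mxE.
    move: vx uy yl vx' uy'; rewrite /level_X /level_Y /= !one1 !zero.
    rewrite !mul0mx !mul1mx !mulmx1 => vx uy yl vx' uy'.
    (* u' w = v' x y l, and l kills im phi. *)
    have c : u' *m w = 0 by rewrite -vx' -yl mulmxA -(mulmxA v') -mulmxA (flag_form fl0) mulmx0.
    exists (u - (u *m w') *m u'); rewrite !mulmxBl -!mulmxA c uw' uy' !mulmx0 mulmx1 !subr0 subrr mul0mx.
    by split.
  - by exists u; split=> //; rewrite [u]flatmx0 [w]thinmx0 ?mulmx0 ?mul0mx.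
exists (col_mx u1 u'), (row_mx w w'); have [c1 c2] := cross.
rewrite /R /S mul_col_row !(mul_col_mx, mul_mx_row, mul_block_col, mul_row_block).
rewrite !(mul0mx, mulmx0, addr0, add0r) uw1 c1 c2 uw' scalar_mx_block.
rewrite vx1 vx' uy1 uy' xw xw' yl yl' !mul_row_col.
by rewrite !(mul0mx, addr0, add0r).
Qed.
End Flag.

(** The names of the shapes describe the part at V1 and V2.  This one is the
    simple representation at V0. *)
Definition shape_end : rep4 := @Rep4 1 0 0 0 0 0 0 0 0 0.

(** The projective-injective representation at V1: the middle part is uniserial
    of length four, the ends are forced by the relations. *)
Definition shape_proj : rep4 := @Rep4 1 (1 + 1) (1 + 1) 1
  (col_mx 1%:M 0) (row_mx 0 1%:M) (block_mx 0 1%:M 0 0) 1%:M (row_mx 0 1%:M) (col_mx 1%:M 0).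

(** Uniserial V1, V2 in the middle, of level i at V1 and of level j at V2. *)
Definition shape_two i j : rep4 := @Rep4 (level_dim i) 1 1 (level_dim j)
  (level_X i) (level_Y i) 0 1%:M (level_Y j) (level_X j).

Definition shape_one i : rep4 := @Rep4 (level_dim i) 1 0 0 (level_X i) (level_Y i) 0 0 0 0.

(** Uniserial V2, V1, V2 in the middle, of level i at V1. *)
Definition shape_three i : rep4 := @Rep4 (level_dim i) 1 (1 + 1) 1
  (level_X i) (level_Y i) (col_mx 1%:M 0) (row_mx 0 1%:M) (row_mx 0 1%:M) (col_mx 1%:M 0).

(** At V1 the sum of shape_one and shape_three, except that the sum of the two
    basis vectors has level i and one of them level j: the flag contains a
    diagonal. *)
Definition shape_glued i j : rep4 :=
  @Rep4 (level_dim i + level_dim j) (1 + 1) (1 + 1) 1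
  (block_mx (level_X i) 0 0 (level_X j)) (block_mx (level_Y i) 0 0 (level_Y j))
  (block_mx 1%:M (- 1%:M) 0 0) (block_mx 0 1%:M 0 0) (row_mx 0 1%:M) (col_mx 1%:M 0).

Section Split.
Variables (d0 d1 d2 d3 : nat).
Variables (x0 : 'M[K]_(d1, d0)) (y0 : 'M[K]_(d0, d1)) (x1 : 'M[K]_(d2, d1))
  (y1 : 'M[K]_(d1, d2)) (x2 : 'M[K]_(d3, d2)) (y2 : 'M[K]_(d2, d3)).
Hypotheses (yx0 : y0 *m x0 = 0) (xy0 : x0 *m y0 = y1 *m x1)
  (xy1 : x1 *m y1 = y2 *m x2) (xy2 : x2 *m y2 = 0).
Local Notation V := (Rep4 x0 y0 x1 y1 x2 y2).
Local Notation F := (flag x0 y0).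
Local Notation G := (flag y2 x2).

Let path_relations : [/\ y2 *m x2 = x1 *m y1, y1 *m x1 *m x0 = 0, y0 *m y1 *m x1 = 0,
   x1 *m y1 *m y2 = 0 & x2 *m x1 *m y1 = 0].
Proof.
rewrite -xy0 -[x2 *m _ *m _]mulmxA xy1 -!mulmxA yx0 xy2 mulmx0 (mulmxA x2) xy2 mul0mx.
by rewrite -[y1 *m x1]xy0 mulmxA yx0 mul0mx mulmx0.
Qed.

Let path_nilpotent : y1 *m x1 *m y1 *m x1 = 0 /\ x1 *m y1 *m x1 *m y1 = 0.
Proof.
split; first by rewrite -mulmxA -xy0 mulmxA -(mulmxA x0) yx0 mulmx0 mul0mx.
by rewrite -mulmxA xy1 mulmxA -(mulmxA y2) xy2 mulmx0 mul0mx.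
Qed.

Definition mx_simpl := (mul0mx, mulmx0, mul1mx, mulmx1, addr0, add0r, subr0).

(** The socle of the summand, detected by a form that kills the second layer,
    is pulled back along the path to dual bases. *)
Lemma split_proj : y1 *m x1 *m y1 != 0 -> summand shape_proj V.
Proof.
have [r1 r2 r3 r4 r5] := path_relations; have [r6 r7] := path_nilpotent.
case/rowV0Pn => _ /submxP[a ->] nz.
pose b := a *m y1; pose a' := b *m x1; pose b' := a' *m y1.
have b'E : a *m (y1 *m x1 *m y1) = b' by rewrite !mulmxA.
rewrite b'E in nz.
(* The rows a, b, a', b' run down the uniserial part; the columns n, m1, n1, m
   are their duals. *)
have b'x : b' *m x1 = 0.
  by rewrite /b' /a' /b -!mulmxA (mulmxA y1) (mulmxA (y1 *m x1)) r6 mulmx0.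
have [m [bm b'm]] : exists m, b *m m = 0 /\ b' *m m = 1%:M.
  apply: separating_form; apply/negP => /sub_rVP[k e].
  have /eqP := congr1 (fun z => z *m x1 *m y1) e.
  rewrite b'x mul0mx -!scalemxAl -/a' -/b' eq_sym scaler_eq0 (negPf nz) orbF => /eqP k0.
  by move: nz; rewrite e k0 scale0r eqxx.
pose n1 := y1 *m m; pose m1 := x1 *m n1; pose n := y1 *m m1.
pose c := a *m x0; pose e := b *m y2; pose g := y0 *m n1; pose h := x2 *m m.
have cy : c *m y0 = a' by rewrite /c -mulmxA xy0 mulmxA.
have ex : e *m x2 = b' by rewrite /e -mulmxA r1 mulmxA.
have a'x : a' *m x0 = 0 by rewrite /a' /b -!mulmxA (mulmxA y1) r2 !mulmx0.
have b'y : b' *m y2 = 0 by rewrite /b' /a' -!mulmxA (mulmxA x1) r4 !mulmx0.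
have xg : x0 *m g = n by rewrite /g mulmxA xy0 -mulmxA.
have yh : y2 *m h = m1 by rewrite /h mulmxA r1 -mulmxA.
have xn : x1 *m n = 0.
  by rewrite /n /m1 /n1 !mulmxA r7 mul0mx.
have xm1 : x2 *m m1 = 0 by rewrite /m1 /n1 !mulmxA r5 mul0mx.
have yn : y0 *m n = 0 by rewrite /n /m1 /n1 !mulmxA r3 !mul0mx.
have a'n1 : a' *m n1 = 1%:M by rewrite /n1 mulmxA.
have bm1 : b *m m1 = 1%:M by rewrite /m1 mulmxA.
have b'm1 : b' *m m1 = 0 by rewrite /m1 mulmxA b'x mul0mx.
have a'n : a' *m n = 0 by rewrite /n mulmxA.
have an : a *m n = 1%:M by rewrite /n mulmxA.
have an1 : a *m n1 = 0 by rewrite /n1 mulmxA.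
exists c, (col_mx a a'), (col_mx b b'), e, g, (row_mx n n1), (row_mx m1 m), h.
rewrite /= !mul_col_row !(mul_block_col, mul_row_block, mul_col_mx, mul_mx_row, mul_row_col).
rewrite -/b -/a' -/b' -/e !mx_simpl !scalar_mx_block.
have cg : c *m g = 1%:M by rewrite /g mulmxA cy.
have eh : e *m h = 1%:M by rewrite /h mulmxA ex.
by rewrite cg eh an an1 a'n a'n1 bm bm1 b'm b'm1 a'x b'x b'y xn xm1 yn.
Qed.

(** A vector b violating the inclusion is the image of some a of level i and
    has level j itself; a form that separates b from the right-hand side
    pulls back to a form for a. *)
Lemma split_two i j : (i < 3)%N -> (j < 3)%N ->
  ~~ ((F i.+1 *m y1 :&: G j.+1)%MS <= F i *m y1 + G j)%MS -> summand (shape_two i j) V.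
Proof.
move=> i3 j3 /row_subPn[k]; set b := row k _ => bn.
have : (b <= (F i.+1 *m y1 :&: G j.+1))%MS by apply: row_sub.
rewrite sub_capmx => /andP[/submxP[D bE] bG]; pose a := D *m F i.+1.
have [m [Fm Gm bm]] := separating_form2 bn.
have aF : (a <= F i.+1)%MS by apply: submxMl.
have ay : a *m y1 = b by rewrite bE mulmxA.
pose l := y1 *m m.
have Fl : F i *m l = 0 by rewrite mulmxA.
have al : a *m l = 1%:M by rewrite mulmxA ay.
have [u0 [w0 [uw0 ax uy xw yl]]] := level_extend yx0 i3 aF Fl al.
have [u3 [w3 [uw3 bx uy3 xw3 yl3]]] := level_extend xy2 j3 bG Gm bm.
have bx1 : b *m x1 = 0.
  rewrite -ay -mulmxA -xy0; apply/sub_kermxP.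
  by apply: (submx_trans aF); apply/sub_kermxP; apply: flag_square.
have xl : x1 *m l = 0 by rewrite mulmxA xy1; apply: (flag_form xy2 Gm).
exists u0, a, b, u3, w0, l, m, w3; rewrite /= !mx_simpl.
by split; split.
Qed.

Lemma split_one i : (i < 3)%N ->
  ~~ ((kermx y1 :&: F i.+1)%MS <= F i + x1)%MS -> summand (shape_one i) V.
Proof.
move=> i3 /row_subPn[k]; set a := row k _ => an.
have : (a <= kermx y1 :&: F i.+1)%MS by apply: row_sub.
rewrite sub_capmx => /andP[/sub_kermxP ay aF].
have [l [Fl xl al]] := separating_form2 an.
have [u0 [w0 [uw0 ax uy xw yl]]] := level_extend yx0 i3 aF Fl al.
exists u0, a, 0, 0, w0, l, 0, 0; rewrite /= !mx_simpl.
by split; split=> //; apply/matrixP => - [].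
Qed.

(** Common to shape_three and shape_glued: a vector d in the image of V2 and a
    form l that factors through V2 extend to the whole of the uniserial part
    V2, V1, V2, and then to V3, which is forced by the relation at V2. *)
Lemma middle_extend (t : 'rV_d2) (l : 'cV_d1) : let d := t *m x1 in
  d *m (y1 *m x1) = 0 -> y1 *m x1 *m l = 0 -> kermx y1 *m l = 0 -> d *m l = 1%:M ->
  exists (u2 : 'M_(1 + 1, d2)) (u3 : 'rV_d3) (w2 : 'M_(d2, 1 + 1)) (w3 : 'cV_d3),
  [/\ u2 *m w2 = 1%:M /\ u3 *m w3 = 1%:M,
      u2 *m x1 = col_mx d 0 /\ d *m y1 = row_mx 0 1%:M *m u2,
      u3 *m x2 = row_mx 0 1%:M *m u2 /\ u2 *m y2 = col_mx 1%:M 0 *m u3,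
      x1 *m l = w2 *m col_mx 1%:M 0 /\ y1 *m w2 = row_mx 0 l &
      x2 *m w2 = w3 *m row_mx 0 1%:M /\ y2 *m w3 = w2 *m col_mx 1%:M 0].
Proof.
move=> d dyx yxl /factor_form[r rE] dl.
have [r1 r2 r3 r4 r5] := path_relations; have [r6 r7] := path_nilpotent.
pose s := d *m y1.
have sr : s *m r = 1%:M by rewrite -mulmxA rE.
have sx : s *m x1 = 0 by rewrite -mulmxA.
have sy : s *m y2 = 0 by rewrite /s /d -!mulmxA (mulmxA x1) r4 mulmx0.
(* Moving the top along the socle makes it orthogonal to the form. *)
pose t' := t - (t *m r) *m s.
have t'x : t' *m x1 = d by rewrite mulmxBl -(mulmxA (t *m r)) sx mulmx0 subr0.
have t'r : t' *m r = 0 by rewrite mulmxBl -(mulmxA (t *m r)) sr mulmx1 subrr.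
have t'xl : t' *m (x1 *m l) = 1%:M by rewrite mulmxA t'x.
have sxl : s *m (x1 *m l) = 0 by rewrite (mulmxA s x1 l) sx mul0mx.
have ex : t' *m y2 *m x2 = s by rewrite -mulmxA r1 mulmxA t'x.
have er : t' *m y2 *m (x2 *m r) = 1%:M by rewrite mulmxA ex.
have yh : y2 *m (x2 *m r) = x1 *m l by rewrite mulmxA r1 -mulmxA rE.
have xxl : x2 *m (x1 *m l) = 0 by rewrite -rE !mulmxA r5 mul0mx.
exists (col_mx t' s), (t' *m y2), (row_mx (x1 *m l) r), (x2 *m r).
rewrite !mul_col_row !(mul_col_mx, mul_mx_row, mul_row_col) !mx_simpl scalar_mx_block.
by rewrite t'x t'r t'xl sxl sr sx sy ex er yh xxl rE mulmxA yxl.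
Qed.

Lemma split_three i : (i < 3)%N ->
  ~~ ((x1 :&: F i.+1)%MS <= F i + kermx y1)%MS -> summand (shape_three i) V.
Proof.
move=> i3 /row_subPn[k]; set a := row k _ => an.
have : (a <= x1 :&: F i.+1)%MS by apply: row_sub.
rewrite sub_capmx => /andP[/submxP[t tE] aF].
have [l [Fl kl al]] := separating_form2 an.
have [u0 [w0 [uw0 ax uy xw yl]]] := level_extend yx0 i3 aF Fl al.
have yxl : y1 *m x1 *m l = 0 by rewrite -xy0; apply: flag_form Fl.
have ayx : a *m (y1 *m x1) = 0.
  rewrite -xy0; apply/sub_kermxP.
  by apply: (submx_trans aF); apply/sub_kermxP; apply: flag_square.
clearbody a; subst a.
have [u2 [u3 [w2 [w3 [[? ?] [ux ay] [? ?] [? yw] [? ?]]]]]] := middle_extend ayx yxl kl al.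
exists u0, (t *m x1), u2, u3, w0, l, w2, w3.
by split; split=> //=; rewrite ?ux ?ay ?yw ?mul_col_mx ?mul_mx_row !mx_simpl.
Qed.

(** With A = ker y1 and D = im x1, the two forms al and de must kill D and A
    respectively and agree on term j of the flag.  Such a pair with al a = 1 is a
    form on V1 + V1; it exists unless a lies in term j, because A and D meet
    only in term 0. *)
Lemma split_glued i j (a d : 'rV_d1) : (i < j < 3)%N ->
  (x1 :&: kermx y1 <= F 0)%MS -> (F i <= F 0)%MS -> (F 0 <= kermx y1)%MS ->
  (a <= kermx y1)%MS -> (d <= x1)%MS -> ((a + d)%R <= F i.+1)%MS ->
  (a <= F j.+1)%MS -> ~~ (a <= F j)%MS -> summand (shape_glued i j) V.
Proof.
move=> /andP[ij j3] DA Fi F0A aA dD adF aF aFj.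
have i3 : (i < 3)%N by apply: ltn_trans j3.
have [al [de [xal kde Fal ada]]] : exists al de : 'cV_d1,
    [/\ x1 *m al = 0, kermx y1 *m de = 0, F j *m (al - de) = 0 & a *m al = 1%:M].
  (* The columns of al and de stacked must kill these three families of rows. *)
  pose U := col_mx (row_mx x1 0) (col_mx (row_mx 0 (kermx y1)) (row_mx (F j) (- F j))).
  have [] := @separating_form _ _ _ U (row_mx a 0).
    apply/negP => /submxP[D]; rewrite -[D]hsubmxK -[rsubmx D]hsubmxK.
    move: (lsubmx D) (lsubmx (rsubmx D)) (rsubmx (rsubmx D)) => D1 D2 D3.
    rewrite /U !mul_row_col !mul_mx_row !mx_simpl !add_row_mx !mx_simpl => /eq_row_mx[aE /esym/eqP].
    rewrite mulmxN subr_eq0 => /eqP DE; case/negP: aFj.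
    rewrite aE addmx_sub ?submxMl // (submx_trans _ (flag_le yx0 (leq0n j))) //.
    apply: submx_trans DA; rewrite sub_capmx submxMl /=.
    have -> : D1 *m x1 = a - D3 *m F j by rewrite aE addrK.
    by rewrite -DE addmx_sub // eqmx_opp submxMl.
  move=> L; rewrite -[L]vsubmxK; move: (usubmx L) (dsubmx L) => al de [].
  rewrite /U !mul_col_mx !mul_row_col !mx_simpl => /eqP; rewrite !col_mx_eq0.
  case/and3P => /eqP xal /eqP kde /eqP Fde ada; exists al, de.
  by split=> //; rewrite mulmxBr -Fde mulNmx.
have adij : ((a + d)%R <= F j)%MS by apply: submx_trans (flag_le yx0 ij).
have Fde : F i *m de = 0.
  by have /submxP[D ->] := submx_trans Fi F0A; rewrite -mulmxA kde mulmx0.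
have ade : a *m de = 0 by have /submxP[D ->] := aA; rewrite -mulmxA kde mulmx0.
have dal : d *m al = 0 by have /submxP[D ->] := dD; rewrite -mulmxA xal mulmx0.
have dde : d *m de = 1%:M.
  have : (a + d) *m (al - de) = 0 by have /submxP[D ->] := adij; rewrite -mulmxA Fal mulmx0.
  rewrite mulmxBr !mulmxDl ada ade dal addr0 add0r => /eqP; rewrite subr_eq0.
  by move=> /eqP.
have e1 : (a + d) *m de = 1%:M by rewrite mulmxDl ade dde add0r.
have e2 : a *m (al - de) = 1%:M by rewrite mulmxBr ada ade subr0.
have e3 : (a + d) *m (al - de) = 0.
  by rewrite mulmxBr !mulmxDl ada ade dal dde addr0 add0r subrr.
have [u [w [uw vx uy xw yl]]] :=
  level_extend2 yx0 (introT andP (conj ij j3)) adF aF Fde Fal e1 e2 e3 ade.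
have [t tE] := submxP dD.
have dyx : d *m (y1 *m x1) = 0.
  rewrite -xy0; apply/sub_kermxP; rewrite -[d](addKr a) addrC.
  rewrite addmx_sub ?eqmx_opp //; apply/sub_kermxP.
    have /submxP[D ->] := adF; rewrite -mulmxA flag_square ?mulmx0 //.
  by have /submxP[D ->] := aF; rewrite -mulmxA flag_square ?mulmx0.
have yxl : y1 *m x1 *m de = 0 by rewrite -xy0; apply: flag_form Fde.
subst d.
have [u2 [u3 [w2 [w3 [[uw2 ?] [ux dy] [? ?] [xde yw] [? ?]]]]]] := middle_extend dyx yxl kde dde.
have ay : a *m y1 = 0 by apply/sub_kermxP.
exists u, (col_mx (a + t *m x1) a), u2, u3, w, (row_mx de (al - de)), w2, w3.
split; split=> //=.
- by rewrite mul_col_row e1 e2 e3 ade scalar_mx_block.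
- by rewrite ux mul_block_col mulNmx !mx_simpl addrC addKr.
- by rewrite /block_mx !mul_col_mx mulmxDl ay dy row_mx0 !mx_simpl.
- rewrite block_mxEh !mul_mx_row -xde mulmxBr xal sub0r.
  by rewrite -[col_mx (- _) 0]/(col_mx _ _) -(oppr0 _) -opp_col_mx mulmxN -xde.
- by rewrite yw mul_row_block !mx_simpl.
Qed.

(** The inclusions say that no uniserial V1, V2 splits off; by cap_flags they
    add up to the statement that a vector killed by phi has its image in the
    image of psi. *)
Lemma no_two_kernel :
  (forall i j, (i < 3)%N -> (j < 3)%N -> (F i.+1 *m y1 :&: G j.+1 <= F i *m y1 + G j)%MS) ->
  (kermx (x0 *m y0) *m y1 <= x1 *m y1)%MS.
Proof.
move=> noI; have [r1 r2 r3 r4 r5] := path_relations.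
have FG : (F 3 *m y1 :&: G 3 <= F 0 *m y1 + G 0)%MS.
  apply: (@cap_flags K d1 d2 d2 (fun i => F i *m y1) G 3) => // i _.
    exact/submxMr/flagS.
  exact: flagS.
have FG0 : (F 0 *m y1 + G 0 <= x1 *m y1)%MS.
  rewrite addsmx_sub genmxE -r1 submx_refl andbT (eqmxMr _ (genmxE _)) xy0.
  by rewrite -mulmxA r1 submxMl.
apply: submx_trans FG0; apply: submx_trans FG; rewrite sub_capmx submx_refl.
by apply/sub_kermxP; rewrite /= r1 xy0 -mulmxA (mulmxA y1) mulmxA mulmx_ker mul0mx.
Qed.

(** By the two inclusions of images of kernels, modulo term 0 the last term of the
    flag is the direct sum of A = ker y1 and D = im x1.  Climbing the flag, let
    z = a + d be an element of the first term not contained in term 0.  If a lies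
    in the same term, the inclusions that exclude shape_one and shape_three put a
    and d into term 0; otherwise a enters the flag at a later term j, and
    split_glued splits off a summand. *)
Lemma no_summand_flag :
  y1 *m x1 *m y1 = 0 -> x1 *m y1 *m x1 = 0 ->
  (kermx (x0 *m y0) *m y1 <= x1 *m y1)%MS ->
  (kermx (x1 *m y1) *m x1 <= y1 *m x1)%MS ->
  (forall i, (i < 3)%N -> ((kermx y1 :&: F i.+1)%MS <= F i + x1)%MS) ->
  (forall i, (i < 3)%N -> ((x1 :&: F i.+1)%MS <= F i + kermx y1)%MS) ->
  (forall i j, (i < j < 3)%N -> ~ summand (shape_glued i j) V) ->
  (kermx (x0 *m y0) <= x0 *m y0)%MS.
Proof.
move=> yxy xyx h1 h2 noA noD noAD.
have F0A : (F 0 <= kermx y1)%MS by rewrite genmxE xy0; apply/sub_kermxP.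
have F0D : (F 0 <= x1)%MS by rewrite genmxE xy0 submxMl.
have DA : (x1 :&: kermx y1 <= F 0)%MS.
  apply/rV_subP => z; rewrite sub_capmx => /andP[/submxP[w ->] /sub_kermxP wxy].
  rewrite genmxE xy0; apply: submx_trans h2; apply: submxMr.
  by apply/sub_kermxP; rewrite mulmxA.
have AF : (kermx y1 <= F 3)%MS.
  by apply/sub_kermxP; rewrite xy0 mulmxA mulmx_ker mul0mx.
have FAD : (F 3 <= kermx y1 + x1)%MS.
  apply/rV_subP => z zF; have : (z *m y1 <= x1 *m y1)%MS.
    by apply: submx_trans h1; apply: submxMr.
  case/submxP => w; rewrite mulmxA => e; rewrite -(subrK (w *m x1) z) addmx_sub_adds ?submxMl //.
  by apply/sub_kermxP; rewrite mulmxBl e subrr.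
have collapse i : (i <= 3)%N -> (F i <= F 0)%MS.
  elim: i => // i IH i3; have Fi := IH (ltnW i3).
  apply/rV_subP => z zF; have : (z <= kermx y1 + x1)%MS.
    by apply: submx_trans FAD; apply: submx_trans zF (flag_le yx0 i3).
  case/sub_addsmxP => -[u v] /= zE; set a := u *m _ in zE; set d := v *m _ in zE.
  have aA : (a <= kermx y1)%MS by apply: submxMl.
  have dD : (d <= x1)%MS by apply: submxMl.
  have [aF|aF] := boolP (a <= F i.+1)%MS.
    have dF : (d <= F i.+1)%MS by rewrite -(addKr a d) -zE addrC addmx_sub // eqmx_opp.
    rewrite zE addmx_sub //.
      apply: submx_trans DA; rewrite sub_capmx aA andbT.
      have : (a <= F i + x1)%MS by apply: submx_trans (noA i i3); rewrite sub_capmx aA.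
      move=> /submx_trans; apply; rewrite addsmx_sub submx_refl andbT.
      exact: submx_trans F0D.
    apply: submx_trans DA; rewrite sub_capmx dD /=.
    have : (d <= F i + kermx y1)%MS by apply: submx_trans (noD i i3); rewrite sub_capmx dD.
    move=> /submx_trans; apply; rewrite addsmx_sub submx_refl andbT.
    exact: submx_trans F0A.
  have a3 : (a <= F 3)%MS by apply: submx_trans AF.
  have [j [ij j3 aj aj']] : exists j,
      [/\ (i < j)%N, (j < 3)%N, (a <= F j.+1)%MS & ~~ (a <= F j)%MS].
    (* The first term after the i-th one that contains a. *)
  have ex : exists k, ~~ ((i < k)%N ==> ~~ (a <= F k)%MS) by exists 3; rewrite i3 a3.
    case: (ex_minnP ex) => -[|k]; rewrite negb_imply negbK => /andP[ik ak] kmin; first by [].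
    exists k; split=> //.
    - move: ik; rewrite ltnS leq_eqVlt => /orP[/eqP e|//].
      by rewrite e ak in aF.
    - by have := kmin 3; rewrite i3 a3 => /(_ isT).
    - apply/negP => ak'; have := kmin k; rewrite negb_imply negbK ak' andbT ltnn.
      move: ik; rewrite ltnS leq_eqVlt => /orP[/eqP e|-> /(_ isT) //].
      by rewrite e ak in aF.
  case: (noAD i j); first by rewrite ij.
  by apply: split_glued DA Fi F0A aA dD _ aj aj'; rewrite ?ij // -zE.
by have := collapse 3 isT; rewrite genmxE.
Qed.

(** Exactness of psi makes y1 factor through x1 y1, whence phi = 0; then
    exactness of phi says that V1 is zero. *)
Lemma no_summand_zero : y1 *m x1 *m y1 = 0 -> x1 *m y1 *m x1 = 0 ->
  (kermx (x0 *m y0) <= x0 *m y0)%MS -> (kermx (x1 *m y1) <= x1 *m y1)%MS -> d1 = 0%N.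
Proof.
move=> yxy xyx k1 k2.
have phi0 : x0 *m y0 = 0.
  rewrite xy0; have /submxP[D yE] : (y1 <= x1 *m y1)%MS.
    by apply: submx_trans k2; apply/sub_kermxP; rewrite mulmxA.
  by rewrite yE -mulmxA xyx mulmx0.
move: k1; rewrite phi0 submx0 => /eqP /(congr1 (mulmx 1%:M)).
rewrite mul1mx mulmx0 => k0; apply/eqP; rewrite -(mxrank1 K d1) mxrank_eq0.
by rewrite -submx0 -k0; apply/sub_kermxP; rewrite mulmx0.
Qed.

End Split.

Definition shape_of (c : bool * 'I_6 * 'I_3 * 'I_3) : rep4 :=
  let: (b, k, i, j) := c in
  (if b then mirror else id)
    (nth shape_end [:: shape_end; shape_proj; shape_two i j;
        shape_one i; shape_three i; shape_glued i j] k).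

Lemma shape_of_gt0 c :
  (0 < dim0 (shape_of c) + dim1 (shape_of c) + dim2 (shape_of c) + dim3 (shape_of c))%N.
Proof.
by case: c => [[[[] [[|[|[|[|[|[|k]]]]]] //= _]] i] j]; rewrite ?addnS.
Qed.

(** If nothing splits off, V1 and V2 vanish by no_summand_zero, and a nonzero
    vector at an end spans a simple summand. *)
Theorem exists_summand V : relations V ->
  (0 < dim0 V + dim1 V + dim2 V + dim3 V)%N -> exists c, summand (shape_of c) V.
Proof.
case: V => d0 d1 d2 d3 x0 y0 x1 y1 x2 y2 [/= yx0 xy0 xy1 xy2] pos.
apply: contrapT => none.
set V := Rep4 _ _ _ _ _ _ in none.
have noV (k : 'I_6) i j : ~ summand (shape_of (false, k, i, j)) V.
  by move=> h; apply: none; exists (false, k, i, j).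
have noM (k : 'I_6) i j : ~ summand (shape_of (false, k, i, j)) (mirror V).
  by move=> /mirror_summand h; apply: none; exists (true, k, i, j).
have half e0 e1 e2 e3 (a0 : 'M[K]_(e1, e0)) b0 (a1 : 'M_(e2, e1)) b1 (a2 : 'M_(e3, e2)) b2 :
    relations (Rep4 a0 b0 a1 b1 a2 b2) ->
    (forall k i j, ~ summand (shape_of (false, k, i, j)) (Rep4 a0 b0 a1 b1 a2 b2)) ->
    [/\ b1 *m a1 *m b1 = 0, (kermx (a0 *m b0) *m b1 <= a1 *m b1)%MS,
     forall i, (i < 3)%N -> ((kermx b1 :&: flag a0 b0 i.+1)%MS <= flag a0 b0 i + a1)%MS &
     forall i, (i < 3)%N -> ((a1 :&: flag a0 b0 i.+1)%MS <= flag a0 b0 i + kermx b1)%MS].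
  case=> /= r1 r2 r3 r4 no; split.
  - apply/eqP; apply: contrapT => /negP nz.
    by apply: (no (@Ordinal 6 1 isT) ord0 ord0); apply: split_proj nz.
  - apply: (no_two_kernel (x2 := a2) (y2 := b2)) => // i j i3 j3; apply: contrapT => /negP nle.
    by apply: (no (@Ordinal 6 2 isT) (Ordinal i3) (Ordinal j3)); apply: split_two nle.
  - move=> i i3; apply: contrapT => /negP nle.
    by apply: (no (@Ordinal 6 3 isT) (Ordinal i3) ord0); apply: split_one nle.
  - move=> i i3; apply: contrapT => /negP nle.
    by apply: (no (@Ordinal 6 4 isT) (Ordinal i3) ord0); apply: split_three nle.
have rV : relations V by split.
have [yxy h1 noA noD] := half _ _ _ _ _ _ _ _ _ _ rV noV.
have [xyx h2 noA' noD'] := half _ _ _ _ _ _ _ _ _ _ (mirror_relations rV) noM.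
have ijP i j : (i < j < 3)%N -> (i < 3)%N by case/andP => ij j3; apply: ltn_trans j3.
have k1 : (kermx (x0 *m y0) <= x0 *m y0)%MS.
  apply: (no_summand_flag yx0 xy0 xy1 xy2) => //.
    by rewrite xy1.
  move=> i j ij; have /andP[_ j3] := ij.
  exact: (noV (@Ordinal 6 5 isT) (Ordinal (ijP _ _ ij)) (Ordinal j3)).
have k2 : (kermx (y2 *m x2) <= y2 *m x2)%MS.
  apply: (no_summand_flag xy2 (esym xy1) (esym xy0) yx0) => //.
    by rewrite -xy0.
  move=> i j ij; have /andP[_ j3] := ij.
  exact: (noM (@Ordinal 6 5 isT) (Ordinal (ijP _ _ ij)) (Ordinal j3)).
have z1 : d1 = 0%N.
  by apply: (@no_summand_zero _ _ _ x0 y0 x1 y1) => //; rewrite xy1.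
have z2 : d2 = 0%N.
  by apply: (@no_summand_zero _ _ _ y2 x2 y1 x1) => //; rewrite -xy0.
have simple e0 e1 e2 e3 (a0 : 'M[K]_(e1, e0)) b0 (a1 : 'M_(e2, e1)) b1 (a2 : 'M_(e3, e2)) b2 :
    e1 = 0%N -> e2 = 0%N -> (0 < e0)%N -> summand shape_end (Rep4 a0 b0 a1 b1 a2 b2).
  case: e0 a0 b0 => // e0 a0 b0 e10 e20 _; subst e1 e2.
  exists (delta_mx 0 0), 0, 0, 0, (delta_mx 0 0), 0, 0, 0 => /=; split; split;
    try by [apply: flatmx0 | apply: thinmx0 | apply/matrixP => - []| apply/matrixP => ? []].
  by rewrite mul_delta_mx; apply/matrixP => i j; rewrite !ord1 !mxE.
case: (posnP d0) => [z0|d0_gt0].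
  apply: (noM (@Ordinal 6 0 isT) ord0 ord0); apply: simple => //.
  by rewrite z0 z1 z2 in pos.
apply: (noV (@Ordinal 6 0 isT) ord0 ord0); exact: simple.
Qed.

End Rep4.

(** * Finiteness for the preprojective algebra of A4 *)

Section Fixed.
Variables (K : fieldType) (A : algType K) (M : lmodType A) (p : {linear M -> M}).

Definition fixed_pred : {pred M} := fun x => p x == x.

Lemma fixed_submod : submod_closed fixed_pred.
Proof.
split=> [|a x y]; rewrite !unfold_in ?raddf0 //.
by move=> /eqP px /eqP py; rewrite linearP px py.
Qed.
HB.instance Definition _ := GRing.isSubmodClosed.Build A M fixed_pred fixed_submod.

Record fixed := Fixed { fixed_val :> M; _ : fixed_val \in fixed_pred }.
HB.instance Definition _ := [isSub for fixed_val].
HB.instance Definition _ := [Choice of fixed by <:].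
HB.instance Definition _ := [SubChoice_isSubLmodule of fixed by <:].

Lemma fixedP (x : fixed) : p (val x) = val x.
Proof. by apply/eqP; exact: (valP x). Qed.

End Fixed.

Section Idempotent.
Variables (K : fieldType) (A : algType K) (M : lmodType A) (p : {linear M -> M}).
Hypothesis pp : forall x, p (p x) = p x.

Let q (x : M) : M := x - p x.
Let q_linear : linear q.
Proof. by move=> a x y; rewrite /q linearP scalerBr opprD addrACA. Qed.
HB.instance Definition _ := GRing.isLinear.Build _ _ _ _ q q_linear.

Let in1 x : p x \in fixed_pred p. Proof. by rewrite unfold_in pp. Qed.
Let in2 x : q x \in fixed_pred q.
Proof. by rewrite unfold_in /= /q linearB pp subrr subr0. Qed.

Let f (x : M) : (fixed p * fixed q)%type := (Fixed (in1 x), Fixed (in2 x)).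
Let f_linear : linear f.
Proof.
move=> a x y; congr pair; apply: val_inj; rewrite /= ?linearP //.
Qed.
HB.instance Definition _ := GRing.isLinear.Build _ _ _ _ f f_linear.

(** The module is the direct sum of the fixed points of p and of 1 - p. *)
Lemma indecomposable_idempotent :
  indecomposable M -> (exists x, p x <> 0) -> forall x, p x = x.
Proof.
case=> _ dec [x0 px0] x.
have f_bij : bijective f.
  exists (fun z => val z.1 + val z.2) => [y|[y z]] /=; first by rewrite /q addrC subrK.
  have pz : p (val z) = 0.
    have := fixedP z; rewrite /= /q => /eqP; rewrite -subr_eq0 addrAC subrr add0r oppr_eq0.
    by move=> /eqP.
  have py := fixedP y.
  congr pair; apply: val_inj => /=; rewrite ?/q linearD py pz addr0 //.
  by rewrite addrC addKr.
case: (dec _ _ (ex_intro _ (f : {linear _ -> _}) f_bij)) => z.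
  by case: px0; have := congr1 val (z (Fixed (in1 x0))).
by have := congr1 val (z (Fixed (in2 x))) => /= /eqP; rewrite /q subr_eq0 => /eqP.
Qed.

End Idempotent.

Section Coordinates.
Variables (K : fieldType) (A : algType K) (M : lmodType A).

Definition comb d (b : 'I_d -> M) (v : 'rV[K]_d) : M := \sum_i (v 0 i)%:A *: b i.

Lemma combD d (b : 'I_d -> M) u v : comb b (u + v) = comb b u + comb b v.
Proof.
by rewrite -big_split; apply: eq_bigr => i _; rewrite mxE scalerDl scalerDl.
Qed.

Lemma combZ d (b : 'I_d -> M) k v : comb b (k *: v) = k%:A *: comb b v.
Proof.
rewrite scaler_sumr; apply: eq_bigr => i _.
by rewrite mxE [in RHS]scalerA -scalerAl mul1r scalerA.
Qed.

Record coords (e : A) := Coords {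
  cdim : nat;
  coord_of : M -> 'rV[K]_cdim;
  of_coord : 'rV[K]_cdim -> M;
  coord_ofD : {morph coord_of : x y / x + y};
  coord_ofZ : forall k x, coord_of (k%:A *: x) = k *: coord_of x;
  of_coordD : {morph of_coord : u v / u + v};
  of_coordZ : forall k v, of_coord (k *: v) = k%:A *: of_coord v;
  of_coordK : cancel of_coord coord_of;
  coord_ofK : forall x, of_coord (coord_of x) = e *: x }.

(** A spanning family of least length is free; the coordinates are those in such
    a family. *)
Lemma coords_exist e : fin_dim M -> e * e = e -> coords e.
Proof.
move=> fM ee.
pose spans d := `[< exists b : 'I_d -> M, (forall i, e *: b i = b i) /\
  forall x, exists v, e *: x = comb b v >].
have ex_spans : exists d, spans d.
  have [m [b bP]] := fM; exists m; apply/asboolP; exists (fun i => e *: b i).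
  split=> [i|x]; first by rewrite scalerA ee.
  have [c ->] := bP x; exists (\row_i c i); rewrite scaler_sumr.
  apply: eq_bigr => i _; rewrite mxE !scalerA; congr (_ *: _).
  by rewrite -scalerAr mulr1 -scalerAl mul1r.
case: (ex_minnP ex_spans) => d /asboolP/cid[b [be bspan]] dmin.
have binj v : comb b v = 0 -> v = 0.
  move=> v0; apply/rowP => k; rewrite mxE; apply/eqP; apply: contrapT => /negP vk.
  case: d k b be bspan dmin v v0 vk => [[] //|d] k b be bspan dmin v v0 vk.
  suff /dmin : spans d by rewrite ltnn.
  apply/asboolP; exists (fun i => b (lift k i)); split=> // x.
  have [c cE] := bspan x; pose c' := c - (c 0 k / v 0 k) *: v.
  have c'E : e *: x = comb b c'.
    by rewrite combD cE -scaleN1r combZ combZ v0 !scaler0 addr0.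
  exists (\row_i c' 0 (lift k i)); rewrite c'E /comb (bigD1_ord k) //=.
  rewrite [c' 0 k](_ : _ = 0); last by rewrite !mxE divfK ?subrr.
  by rewrite !scale0r add0r; apply: eq_bigr => i _; rewrite mxE.
have combI u v : comb b u = comb b v -> u = v.
  move=> uv; apply/eqP; rewrite -subr_eq0; apply/eqP/binj.
  by rewrite combD uv -scaleN1r combZ scaleNr scale1r scaleN1r subrr.
pose g x := sval (cid (bspan x)).
have gE x : e *: x = comb b (g x) by rewrite /g; case: cid.
have eA k (x : M) : e *: (k%:A *: x) = k%:A *: (e *: x).
  by rewrite !scalerA -scalerAr mulr1 -scalerAl mul1r.
apply: (@Coords e d g (comb b)).
- by move=> x y; apply: combI; rewrite combD -!gE scalerDr.
- by move=> k x; apply: combI; rewrite combZ -!gE eA.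
- exact: combD.
- exact: combZ.
- move=> v; apply: combI; rewrite -gE scaler_sumr; apply: eq_bigr => i _.
  by rewrite eA be.
- by move=> x; rewrite -gE.
Qed.

End Coordinates.

(** An algebra with the generators and relations of the preprojective algebra of
    A4.  Some e i may be 0, which accommodates the shorter diagrams. *)
Section A4System.
Variables (K : fieldType) (A : algType K) (e : nat -> A) (c : A).
Hypothesis e_idem : forall i, e i * e i = e i.
Hypothesis e_orth : forall i j, i != j -> e i * e j = 0.
Hypothesis e_sum : \sum_(i < 4) e i = 1.
Hypothesis e_corner : forall i j, j != i.+1 -> i != j.+1 -> e i * c * e j = 0.
Hypothesis e_square : forall i, e i * c * c * e i = 0.

Hypothesis gen_linear : forall (M N : lmodType A) (f : M -> N),
  {morph f : x y / x + y} -> (forall k x, f (k%:A *: x) = k%:A *: f x) ->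
  (forall i x, (i < 4)%N -> f (e i *: x) = e i *: f x) ->
  (forall x, f (c *: x) = c *: f x) -> linear f.

Section Coord.
Variables (M : lmodType A) (fM : fin_dim M).

Definition vertex_coords i : coords M (e i) := coords_exist fM (e_idem i).
Local Notation cs := vertex_coords.
Local Notation D i := (cdim (cs i)).

Lemma vertex_of_coord i (v : 'rV_(D i)) : e i *: of_coord v = of_coord v.
Proof. by rewrite -(coord_ofK (cs i)) of_coordK. Qed.

Lemma coord_of_vertex i x : coord_of (cs i) (e i *: x) = coord_of (cs i) x.
Proof. by rewrite -(coord_ofK (cs i)) of_coordK. Qed.

Lemma coord_of0 i : coord_of (cs i) 0 = 0.
Proof. by rewrite -(scale0r 0) -(scale0r (1 : A)) coord_ofZ scale0r. Qed.


Lemma coord_of_other i j x : i != j -> coord_of (cs i) (e j *: x) = 0.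
Proof. by move=> ne; rewrite -coord_of_vertex scalerA e_orth // scale0r coord_of0. Qed.

Lemma vertex_decomp x : x = \sum_(j < 4) of_coord (coord_of (cs j) x).
Proof.
rewrite -{1}[x]scale1r -e_sum scaler_suml.
by apply: eq_bigr => j _; rewrite coord_ofK.
Qed.

Definition transfer i j : 'M[K]_(D i, D j) :=
  \matrix_k coord_of (cs j) (c *: of_coord (delta_mx 0 k : 'rV_(D i))).

Lemma algC_scale (a : A) k (x : M) : a *: (k%:A *: x) = k%:A *: (a *: x).
Proof. by rewrite !scalerA -scalerAr mulr1 -scalerAl mul1r. Qed.

Lemma transferE i j (v : 'rV_(D i)) :
  v *m transfer i j = coord_of (cs j) (c *: of_coord v).
Proof.
pose g (v : 'rV_(D i)) := coord_of (cs j) (c *: of_coord v).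
have gl : linear g.
  by move=> k u w; rewrite /g of_coordD of_coordZ scalerDr coord_ofD algC_scale coord_ofZ.
pose G : {linear 'rV_(D i) -> 'rV_(D j)} := HB.pack g (GRing.isLinear.Build _ _ _ _ g gl).
rewrite -[RHS]/(G v) -(mul_rV_lin1 G); congr (_ *m _).
by apply/row_matrixP => k; rewrite rowK rowE mul_rV_lin1.
Qed.

Lemma coord_of_arrow i x :
  coord_of (cs i) (c *: x) = \sum_(j < 4) coord_of (cs j) x *m transfer j i.
Proof.
rewrite {1}[x]vertex_decomp scaler_sumr.
rewrite (big_morph _ (coord_ofD (cs i)) (coord_of0 i)).
by apply: eq_bigr => j _; rewrite transferE.
Qed.

Lemma transfer2E i j k (v : 'rV_(D i)) : v *m (transfer i j *m transfer j k) =
  coord_of (cs k) ((e k * c * e j * c * e i) *: of_coord v).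
Proof.
rewrite mulmxA !transferE coord_ofK -!scalerA vertex_of_coord coord_of_vertex.
by [].
Qed.

Lemma transfer_nonadj i j : j != i.+1 -> i != j.+1 -> transfer i j = 0.
Proof.
move=> h1 h2; apply/row_matrixP => k; rewrite rowE transferE row0.
by rewrite -vertex_of_coord -coord_of_vertex !scalerA e_corner // scale0r coord_of0.
Qed.

Lemma transfer_relation i : \sum_(0 <= j < 4) transfer i j *m transfer j i = 0.
Proof.
rewrite big_mkord; apply/row_matrixP => k; rewrite rowE row0 mulmx_sumr.
under eq_bigr => j _ do rewrite transfer2E.
rewrite -(big_morph _ (coord_ofD (cs i)) (coord_of0 i)) -scaler_suml.
under eq_bigr => j _ do rewrite -[_ * c * e i]mulrA -[_ * e j * _]mulrA.
by rewrite -mulr_sumr -mulr_suml e_sum mul1r mulrA e_square scale0r coord_of0.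
Qed.

(** The sign turns the relation at a middle vertex, two composites adding up to
    zero, into an equality of two composites. *)
Definition coord_rep : rep4 K :=
  Rep4 (transfer 1 0) (transfer 0 1) (transfer 2 1) (- transfer 1 2)
       (transfer 3 2) (transfer 2 3).

Lemma coord_rep_relations : relations coord_rep.
Proof.
have h := transfer_relation; have z i j := @transfer_nonadj i j.
move: (h 0)%N (h 1)%N (h 2)%N (h 3)%N; rewrite unlock /= !addr0.
rewrite (z 0 0)%N // (z 0 2)%N // (z 0 3)%N // (z 1 1)%N // (z 1 3)%N // (z 2 0)%N //.
rewrite (z 2 2)%N // (z 3 0)%N // (z 3 1)%N // (z 3 3)%N // !mul0mx !addr0 !add0r.
move=> h0 h1 h2 h3; split=> //=; rewrite ?mulmxN ?mulNmx //.
  by apply/eqP; rewrite -addr_eq0; apply/eqP.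
by apply/eqP; rewrite eq_sym -addr_eq0 addrC; apply/eqP.
Qed.
End Coord.

Definition dimf (R : rep4 K) i : nat :=
  match i with 0 => dim0 R | 1 => dim1 R | 2 => dim2 R | _ => dim3 R end%N.

(** The sign of Y1 as in coord_rep. *)
Definition arrowf (R : rep4 K) i j : 'M[K]_(dimf R i, dimf R j) :=
  match i, j return 'M[K]_(dimf R i, dimf R j) with
  | 1%N, 0%N => X0 R | 0%N, 1%N => Y0 R | 2%N, 1%N => X1 R | 1%N, 2%N => - Y1 R
  | 3%N, 2%N => X2 R | 2%N, 3%N => Y2 R | _, _ => 0
  end.

Section Summands.
Variable R : rep4 K.

Definition summand_data (M : lmodType A) (fM : fin_dim M)
    (u : forall j, 'M[K]_(dimf R j, cdim (vertex_coords fM j)))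
    (w : forall j, 'M[K]_(cdim (vertex_coords fM j), dimf R j)) : Prop :=
  (forall j, (j < 4)%N -> u j *m w j = 1%:M) /\
  (forall i j, (i < 4)%N -> (j < 4)%N ->
     u i *m transfer fM i j = arrowf R i j *m u j /\
     transfer fM i j *m w j = w i *m arrowf R i j).

Lemma summandP (M : lmodType A) (fM : fin_dim M) :
  summand R (coord_rep fM) -> exists u w, @summand_data M fM u w.
Proof.
case=> u0 [u1 [u2 [u3 [w0 [w1 [w2 [w3
  [/= [i0 i1 i2 i3] [a1 a2 a3] [b1 b2 b3] [c1 c2 c3] [d1 d2 d3]]]]]]]]].
exists (fun j => match j return 'M[K]_(dimf R j, cdim (vertex_coords fM j)) with
  | 0%N => u0 | 1%N => u1 | 2%N => u2 | 3%N => u3 | _ => 0 end).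
exists (fun j => match j return 'M[K]_(cdim (vertex_coords fM j), dimf R j) with
  | 0%N => w0 | 1%N => w1 | 2%N => w2 | 3%N => w3 | _ => 0 end).
split; first by case=> [|[|[|[|]]]].
rewrite mulmxN in b2; rewrite mulNmx in d2.
case=> [|[|[|[|i]]]] // [|[|[|[|j]]]] // _ _ /=; split=> //;
  rewrite ?mulmxN ?mulNmx -?b2 -?d2 ?opprK //;
  by rewrite transfer_nonadj // ?mul0mx ?mulmx0.
Qed.

Section Maps.
Variables (M N : lmodType A) (fM : fin_dim M) (fN : fin_dim N).
Variable w : forall j, 'M[K]_(cdim (vertex_coords fM j), dimf R j).
Variable u : forall j, 'M[K]_(dimf R j, cdim (vertex_coords fN j)).

(** The retraction of M onto the shape followed by the inclusion of the shape
    into N. *)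
Definition summand_map (x : M) : N :=
  \sum_(j < 4) of_coord (coord_of (vertex_coords fM j) x *m w j *m u j).

Lemma coord_of_summand_map i x : (i < 4)%N ->
  coord_of (vertex_coords fN i) (summand_map x) =
  coord_of (vertex_coords fM i) x *m w i *m u i.
Proof.
move=> i4; rewrite /summand_map.
rewrite (big_morph _ (coord_ofD (vertex_coords fN i)) (coord_of0 fN i)).
rewrite (bigD1 (Ordinal i4)) //= of_coordK big1 ?addr0 // => j ne.
by rewrite -vertex_of_coord coord_of_other // eq_sym.
Qed.

Lemma eq_by_coord (x y : N) :
  (forall i, (i < 4)%N -> coord_of (vertex_coords fN i) x = coord_of (vertex_coords fN i) y) ->
  x = y.
Proof.
move=> h; rewrite -[x]scale1r -[y]scale1r -e_sum !scaler_suml.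
by apply: eq_bigr => i _; rewrite -!(coord_ofK (vertex_coords fN i)) h.
Qed.
End Maps.

Lemma summand_map_linear (M N : lmodType A) (fM : fin_dim M) (fN : fin_dim N) uM wM uN wN :
  @summand_data M fM uM wM -> @summand_data N fN uN wN -> linear (summand_map wM uN).
Proof.
move=> [_ hM] [_ hN]; apply: gen_linear => [x y|k x|i x i4|x]; apply: eq_by_coord => j j4.
- by rewrite coord_ofD !coord_of_summand_map // coord_ofD !mulmxDl.
- by rewrite coord_ofZ !coord_of_summand_map // coord_ofZ -!scalemxAl.
- rewrite coord_of_summand_map //; have [->|ne] := eqVneq j i.
    by rewrite !coord_of_vertex coord_of_summand_map.
  by rewrite !coord_of_other // !mul0mx.
- rewrite coord_of_summand_map // !coord_of_arrow !mulmx_suml.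
  apply: eq_bigr => k _; rewrite coord_of_summand_map //.
  have [_ hw] := hM k j (ltn_ord k) j4; have [hu _] := hN k j (ltn_ord k) j4.
  by rewrite -!mulmxA hu (mulmxA (transfer _ _ _)) hw !mulmxA.
Qed.

Lemma summand_map_comp (M N P : lmodType A) (fM : fin_dim M) (fN : fin_dim N)
    (fP : fin_dim P) wM uN wN uP x :
  @summand_data N fN uN wN ->
  summand_map wN uP (summand_map wM uN x) = summand_map (fM := fM) (fN := fP) wM uP x.
Proof.
case=> uw _; apply: eq_by_coord => j j4; rewrite !coord_of_summand_map //.
by rewrite -(mulmxA _ (uN j)) uw // mulmx1.
Qed.

Hypothesis R_gt0 : (0 < dim0 R + dim1 R + dim2 R + dim3 R)%N.

(** The map is the idempotent that projects onto a nonzero summand. *)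
Lemma summand_map_id (M : lmodType A) (fM : fin_dim M) u w :
  @summand_data M fM u w -> indecomposable M -> summand_map w u =1 id.
Proof.
move=> hM Mi; have fl := summand_map_linear hM hM.
pose f : {linear M -> M} := HB.pack (summand_map w u) (GRing.isLinear.Build _ _ _ _ _ fl).
apply: (@indecomposable_idempotent _ _ M f) => //.
  by move=> x /=; apply: summand_map_comp hM.
have [j j4 Rj] : exists2 j, (j < 4)%N & (0 < dimf R j)%N.
  case: (posnP (dim0 R)) R_gt0 => [->|]; last by exists 0%N.
  case: (posnP (dim1 R)) => [->|]; last by exists 1%N.
  case: (posnP (dim2 R)) => [->|]; last by exists 2%N.
  by exists 3%N.
exists (of_coord (row (Ordinal Rj) (u j))) => /(congr1 (coord_of (vertex_coords fM j))).
have [uw _] := hM; rewrite /= coord_of_summand_map // of_coordK coord_of0 -!row_mul uw // mul1mx.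
move=> /(congr1 (mulmxr (w j))) /=; rewrite -row_mul uw // mul0mx.
by move=> /rowP/(_ (Ordinal Rj))/eqP; rewrite !mxE eqxx oner_eq0.
Qed.

Lemma same_summand_iso (M N : lmodType A) (fM : fin_dim M) (fN : fin_dim N) :
  indecomposable M -> indecomposable N ->
  summand R (coord_rep fM) -> summand R (coord_rep fN) -> module_iso M N.
Proof.
move=> Mi Ni /summandP[uM [wM hM]] /summandP[uN [wN hN]].
have fl := summand_map_linear hM hN.
pose f : {linear M -> N} := HB.pack (summand_map wM uN) (GRing.isLinear.Build _ _ _ _ _ fl).
exists f, (summand_map wN uM) => x /=.
  by rewrite (summand_map_comp _ _ _ hN) (summand_map_id hM).
by rewrite (summand_map_comp _ _ _ hM) (summand_map_id hN).
Qed.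

End Summands.

(** One representative is chosen for each shape that occurs; an arbitrary module
    stands in for the other shapes. *)
Theorem A4_representation_finite : representation_finite A.
Proof.
pose T := (bool * 'I_6 * 'I_3 * 'I_3)%type.
pose good (k : T) (M : lmodType A) := exists fM : fin_dim M,
  indecomposable M /\ summand (shape_of K k) (coord_rep fM).
pose F (i : 'I_#|{: T}|) : lmodType A :=
  if pselect (exists M, good (enum_val i) M) is left h then sval (cid h) else A^o.
exists #|{: T}|, F => M fM Mi.
have [k hk] : exists k, summand (shape_of K k) (coord_rep fM).
  apply: exists_summand; first exact: coord_rep_relations.
  rewrite lt0n; apply/negP => /eqP d0.
  case: Mi => nz _; apply: nz => x; apply: (eq_by_coord (fN := fM)) => i i4.
  have z j : (j < 4)%N -> cdim (vertex_coords fM j) = 0%N.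
    by move: d0 => /= /eqP; rewrite !addn_eq0 => /andP[/andP[/andP[/eqP ? /eqP ?] /eqP ?] /eqP ?];
       case: j => [|[|[|[|]]]].
  by apply/rowP => j; have := leq_trans (ltn_ord j) (eq_leq (z i i4)).
exists (enum_rank k); rewrite /F enum_rankK.
case: pselect => [h|[]]; last by exists M, fM.
case: (cid h) => N [fN [Ni hN]] /=.
exact: (same_summand_iso (shape_of_gt0 K k) Mi Ni hk hN).
Qed.

End A4System.

(** * Spectral radius and principal submatrices *)

Section NormalBound.
Variable C : numClosedFieldType.
Local Open Scope sesquilinear_scope.

Definition sqnorm n (x : 'rV[C]_n) : C := \sum_j `|x 0 j| ^+ 2.

Lemma sqnormE n (x : 'rV[C]_n) : sqnorm x = (x *m x^t*) 0 0.
Proof. by rewrite mxE; apply: eq_bigr => j _; rewrite !mxE normCK. Qed.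

Lemma sqnorm_unitary n (P : 'M[C]_n) (x : 'rV[C]_n) :
  P \is unitarymx -> sqnorm (x *m P) = sqnorm x.
Proof.
move=> PU; rewrite !sqnormE trmx_mul map_mxM mulmxA.
by rewrite -(mulmxA x) (unitarymxP PU) mulmx1.
Qed.

(** In an orthonormal basis of eigenvectors each coordinate is stretched by at
    most r. *)
Lemma normal_mx_bound n (A : 'M[C]_n) (r : C) : A \is normalmx -> 0 <= r ->
  (forall a, eigenvalue A a -> `|a| <= r) ->
  forall x : 'rV[C]_n, sqnorm (x *m A) <= r ^+ 2 * sqnorm x.
Proof.
move=> /orthomx_spectralP AE r0 Ar x; set P := spectralmx A in AE.
set D := spectral_diag A in AE.
have PU : P \is unitarymx by apply: spectral_unitarymx.
have Pu : P \in unitmx := spectral_unit A.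
have Dr j : `|D 0 j| <= r.
  apply: Ar; apply/eigenvalueP; exists (row j P).
    rewrite AE -!mulmxA -!row_mul !mulmxA (mulmxV Pu) mul1mx.
    by apply/rowP => k; rewrite !mxE (bigD1 j) //= !mxE eqxx mulr1n big1 ?addr0 // => i ne;
       rewrite !mxE eq_sym (negPf ne) mulr0n mul0r.
  rewrite rowE; apply/eqP => /(congr1 (mulmxr (invmx P)))/=.
  by rewrite mulmxK // mul0mx => /rowP/(_ j)/eqP; rewrite !mxE !eqxx oner_eq0.
have -> : x *m A = (x *m P^t*) *m diag_mx D *m P.
  by rewrite AE (invmx_unitary PU) !mulmxA.
have -> : sqnorm x = sqnorm (x *m P^t*) by rewrite sqnorm_unitary ?trmxC_unitary.
rewrite sqnorm_unitary // mulr_sumr; apply: ler_sum => j _.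
rewrite mul_mx_diag mxE normrM exprMn mulrC ler_wpM2r ?exprn_ge0 //.
by rewrite lerXn2r ?nnegrE.
Qed.

End NormalBound.

Section SkewBound.
Local Open Scope sesquilinear_scope.

Lemma skew_normal n (B : 'M[int]_n) : Defs.skew B ->
  map_mx (intr : int -> algC) B \is normalmx.
Proof.
move=> sB; apply/normalmxP; have -> : (map_mx intr B)^t* = - map_mx (intr : int -> algC) B.
  by apply/matrixP => i j; rewrite !mxE rmorph_int sB rmorphN.
by rewrite mulmxN mulNmx.
Qed.

(** Extending x by zero keeps its length, and the coordinates of x B on the
    window are those of x times the submatrix. *)
Lemma spectral_radius_window n m (Q : quiver n) (f : 'I_m -> 'I_n) (x : 'rV[int]_m) :
  injective f -> exchange_spectrum_radius Q <= 2 ->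
  \sum_j (x *m mxsub f f (exchange_mx Q)) 0 j ^+ 2 <= 4 * \sum_i x 0 i ^+ 2.
Proof.
move=> f_inj /exchange_spectrum_radius_le - /(_ (ler0n _ 2)) Qr.
set B := exchange_mx Q; pose R : 'M[int]_(m, n) := rowsub f 1%:M.
have := normal_mx_bound (skew_normal (exchange_mx_skew Q)) (ler0n _ 2) Qr.
move=> /(_ (map_mx intr (x *m R))); rewrite -map_mxM.
have sqE (y : 'rV[int]_n) : sqnorm (map_mx (intr : int -> algC) y) = (\sum_j y 0 j ^+ 2)%:~R.
  rewrite /sqnorm rmorph_sum; apply: eq_bigr => j _.
  by rewrite mxE -intr_norm -rmorphXn /= real_normK // num_real.
rewrite !sqE (_ : 2%:R ^+ 2 = 4%:~R :> algC); last by rewrite -natrX.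
rewrite -intrM ler_int.
have -> : \sum_j (x *m R) 0 j ^+ 2 = \sum_i x 0 i ^+ 2.
  have E p (y : 'rV[int]_p) : \sum_j y 0 j ^+ 2 = (y *m y^T) 0 0.
    by rewrite mxE; apply: eq_bigr => j _; rewrite mxE.
  rewrite !E trmx_mul mulmxA -(mulmxA x) [R *m R^T](_ : _ = 1%:M) ?mulmx1 //.
  apply/matrixP => i j; rewrite mul_rowsub_mx mul1mx !mxE.
  by rewrite (inj_eq f_inj) eq_sym.
move=> le; apply: le_trans le; rewrite -mulmxA mul_rowsub_mx mul1mx.
rewrite (eq_bigr (fun i => (x *m rowsub f B) 0 (f i) ^+ 2)); last first.
  by move=> i _; congr (_ ^+ 2); rewrite !mxE; apply: eq_bigr => k _; rewrite !mxE.
rewrite (_ : \sum_(i < m) _ = \sum_(j in f @: setT) (x *m rowsub f B) 0 j ^+ 2).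
  by rewrite big_mkcond; apply: ler_sum => j _; case: ifP => _ //; rewrite sqr_ge0.
rewrite big_imset /=; last exact: in2W f_inj.
by apply: eq_bigl => i; rewrite inE.
Qed.

End SkewBound.

(** * Mutations that exceed the bound *)

(** The mutation rule on functions of natural numbers, on which mutations
    compute. *)
Definition mutate (b : nat -> nat -> int) (k i j : nat) : int :=
  if (i == k) || (j == k) then - b i j
  else b i j + Num.sg (b i k) * Num.max (b i k * b k j) 0.

Definition window_table m n (B : 'M[int]_n) (f : 'I_m -> 'I_n) (b : nat -> nat -> int) :=
  forall i j : 'I_m, B (f i) (f j) = b i j.

(** Mutation at a vertex of a full subquiver commutes with restriction to it. *)
Lemma window_mutate m n (B : 'M[int]_n) (f : 'I_m -> 'I_n) b (k : 'I_m) :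
  injective f -> window_table B f b -> window_table (mutate_mx B (f k)) f (mutate b k).
Proof.
by move=> f_inj rB i j; rewrite mxE !(inj_eq f_inj) !rB /mutate -!val_eqE.
Qed.

Lemma window_mutations m n (Q : cluster_quiver n) (f : 'I_m -> 'I_n) b (ks : seq 'I_m) :
  injective f -> window_table (exchange_mx Q) f b ->
  window_table (exchange_mx (foldl (@mutation n) Q (map f ks))) f
    (foldl mutate b (map val ks)).
Proof.
move=> f_inj; elim: ks Q b => [|k ks IH] Q b //= rQ.
by apply: IH; rewrite exchange_mutation; apply: window_mutate.
Qed.

(** The inequality |xb|^2 > 4 |x|^2 for the square table b of size m, with folds
    instead of big operators so that it computes. *)
Definition stretches (m : nat) (b : nat -> nat -> int) (x : seq int) : bool :=
  4 * foldr (fun i s => nth 0 x i ^+ 2 + s) 0 (iota 0 m)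
  < foldr (fun j s => foldr (fun i s => nth 0 x i * b i j + s) 0 (iota 0 m) ^+ 2 + s)
      0 (iota 0 m).

Lemma foldr_iota m (F : nat -> int) :
  foldr (fun i s => F i + s) 0 (iota 0 m) = \sum_(i < m) F i.
Proof.
by rewrite -(big_mkord xpredT F) /index_iota subn0 unlock.
Qed.

Lemma stretches_not_two_maximal m n (Q : cluster_quiver n) (f : 'I_m -> 'I_n)
    b (ks : seq nat) (x : seq int) : injective f -> window_table (exchange_mx Q) f b ->
  all (gtn m) ks -> stretches m (foldl mutate b ks) x -> ~ two_maximal Q.
Proof.
move=> f_inj rQ ksm st Q2.
have [ks' eks] : exists ks' : seq 'I_m, map val ks' = ks.
  exists (pmap insub ks); elim: ks ksm {st} => //= k ks IH /andP[hk /IH e].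
  by rewrite insubT /= e.
have /(spectral_radius_window (\row_i nth 0 x i) f_inj) :
    exchange_spectrum_radius (foldl (@mutation n) Q (map f ks')) <= 2.
  by apply: Q2; exists (map f ks'), 1%g, id; split; [exists id|move=> a; rewrite !perm1].
have := window_mutations ks' f_inj rQ; rewrite eks => rQ'.
rewrite leNgt => /negP; apply; move: st; rewrite /stretches !foldr_iota.
congr (is_true (4 * _ < _)); apply: eq_bigr => j _.
  by rewrite mxE.
congr (_ ^+ 2); rewrite foldr_iota mxE; apply: eq_bigr => i _.
by rewrite [mxsub _ _ _ _ _]mxE rQ' mxE.
Qed.

Definition grid m (l : seq int) : seq (seq int) :=
  iter m (fun g => [seq e :: s | e <- l, s <- g]) [:: [::]].

Lemma mem_grid (l s : seq int) : all (mem l) s -> s \in grid (size s) l.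
Proof.
elim: s => [|e s IH] //= /andP[he /IH hs]; rewrite -/(grid (size s) l).
exact: allpairs_f.
Qed.

Definition signs m := grid m [:: 1; -1].

Definition star_table (s : seq int) (i j : nat) : int :=
  if i == 0%N then (if j == 0%N then 0 else nth 0 s j.-1)
  else if j == 0%N then - nth 0 s i.-1 else 0.

Definition path_table (s : seq int) (i j : nat) : int :=
  if j == i.+1 then nth 0 s i else if i == j.+1 then - nth 0 s j else 0.

(** One or two mutations turn any orientation of the star into two oriented
    triangles with a common edge, for which the eigenvalue of largest modulus
    has square -5. *)
Lemma star_stretches : all (fun s =>
  has (fun ks => has (stretches 4 (foldl mutate (star_table s) ks)) (grid 4 [:: 0; 1; -1]))
    [:: [:: 0]; [:: 1; 0]]%N) (signs 3).
Proof. by vm_compute. Qed.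

(** One or two mutations suffice for every orientation; the rows listed are
    approximate eigenvectors of B B^T for its largest eigenvalue. *)
Lemma path_stretches : all (fun s =>
  has (fun ks => has (stretches 5 (foldl mutate (path_table s) ks))
     [:: [:: 0; -2; 1; 0; 1]; [:: -1; 2; -2; 1; 1]; [:: 1; -1; -1; 2; 0];
         [:: 1; -2; 1; 2; 1]; [:: 1; -2; 0; 2; 1]; [:: 1; 0; -2; 2; 1]])
    [:: [:: 2]; [:: 1; 2]]%N) (signs 4).
Proof. by vm_compute. Qed.

(** * The mutation classes of A1, ..., A4 *)

(** The list holds the entries above the diagonal, row after row: (0, j) is at
    position j - 1 and, for 0 < i < j < 4, (i, j) is at position i + j. *)
Definition skew4 (t : seq int) (i j : nat) : int :=
  if (i < j)%N then nth 0 t (i + j - (i == 0))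
  else if (j < i)%N then - nth 0 t (i + j - (j == 0)) else 0.

Definition mutate4 (t : seq int) (k : nat) : seq int :=
  [seq mutate (skew4 t) k p.1 p.2 |
    p <- [:: (0, 1); (0, 2); (0, 3); (1, 2); (1, 3); (2, 3)]]%N.

Definition path4 (s : seq int) : seq int :=
  [:: nth 0 s 0; 0; 0; nth 0 s 1; 0; nth 0 s 2].

(** Eight rounds close the list; mutation_class4P checks that it is stable. *)
Definition mutation_class4 m : seq (seq int) :=
  iter 8 (fun l => undup (l ++ [seq mutate4 t k | t <- l, k <- iota 0 m]))
    [seq path4 s | s <- signs m.-1].

Definition sum_sq (t : seq int) : int :=
  nth 0 t 0 ^+ 2 + nth 0 t 1 ^+ 2 + nth 0 t 2 ^+ 2 +
  nth 0 t 3 ^+ 2 + nth 0 t 4 ^+ 2 + nth 0 t 5 ^+ 2.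
Definition pfaffian (t : seq int) : int :=
  nth 0 t 0 * nth 0 t 5 - nth 0 t 1 * nth 0 t 4 + nth 0 t 2 * nth 0 t 3.

Definition mutation_class4_check m (L : seq (seq int)) : bool :=
  [&& all (fun t => all (fun k => mutate4 t k \in L) (iota 0 m)) L,
   all (fun t => all (fun k => all (fun i => all (fun j =>
      mutate (skew4 t) k i j == skew4 (mutate4 t k) i j) (iota 0 4)) (iota 0 4)) (iota 0 m)) L,
   all (fun t => (sum_sq t <= 4) && (4 * pfaffian t ^+ 2 <= sum_sq t ^+ 2)) L,
   all (fun t => all (fun i => all (fun j =>
      ((i < m) && (j < m))%N || (skew4 t i j == 0)) (iota 0 4)) (iota 0 4)) L &
   all (fun s => (path4 s \in L) && all (fun i => all (fun j =>
      path_table s i j == skew4 (path4 s) i j) (iota 0 m)) (iota 0 m)) (signs m.-1)].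

Lemma all_iota (p : pred nat) m i : all p (iota 0 m) -> (i < m)%N -> p i.
Proof. by move=> /allP h im; apply: h; rewrite mem_iota. Qed.

Lemma mutation_class4P m : (0 < m <= 4)%N -> exists L : seq (seq int),
  [/\ {in L, forall t k, (k < m)%N -> mutate4 t k \in L},
      {in L, forall t k i j, (k < m)%N -> (i < 4)%N -> (j < 4)%N ->
         mutate (skew4 t) k i j = skew4 (mutate4 t k) i j},
      {in L, forall t, sum_sq t <= 4 /\ 4 * pfaffian t ^+ 2 <= sum_sq t ^+ 2},
      {in L, forall t i j, (i < 4)%N -> (j < 4)%N -> ~~ ((i < m) && (j < m))%N ->
         skew4 t i j = 0} &
      {in signs m.-1, forall s, path4 s \in L /\ forall i j, (i < m)%N -> (j < m)%N ->
         path_table s i j = skew4 (path4 s) i j}].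
Proof.
move=> hm; exists (mutation_class4 m).
have : all (fun m => mutation_class4_check m (mutation_class4 m)) (iota 1 4) by vm_compute.
move=> /allP/(_ m); rewrite mem_iota => /(_ hm).
move: (mutation_class4 m) => L /and5P[h1 h2 h3 h4 h5]; split.
- by move=> t /(allP h1) h k km; have := all_iota h km.
- move=> t /(allP h2) h k i j km i4 j4.
  by have /eqP := all_iota (all_iota (all_iota h km) i4) j4.
- by move=> t /(allP h3)/andP.
- move=> t /(allP h4) h i j i4 j4 /negPf ne.
  by have := all_iota (all_iota h i4) j4; rewrite /= ne => /eqP.
- move=> s /(allP h5)/andP[-> h]; split=> // i j im jm.
  by have /eqP := all_iota (all_iota h im) jm.
Qed.

(** The characteristic polynomial of a skew matrix of size 4, evaluated at the
    matrix. *)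
Lemma skew4_Cayley (t : seq int) : let B := \matrix_(i < 4, j < 4) skew4 t i j in
  (B *m B) *m (B *m B) + sum_sq t *: (B *m B) + (pfaffian t ^+ 2)%:M = 0.
Proof.
move=> B; apply/matrixP => i j; rewrite /B !(mxE, big_ord_recl, big_ord0) /=.
case: i j => [[|[|[|[|i]]]] //= _] [[|[|[|[|j]]]] //= _];
  rewrite /skew4 /= /sum_sq /pfaffian; ring.
Qed.

(** Completing the square, (2 a^2 + S)^2 = S^2 - 4 P^2 lies between 0 and S^2, so
    |2 a^2| <= 2 S <= 8. *)
Lemma eigenvalue_bound (a S P : algC) : 0 <= S -> S <= 4 -> P \is Num.real ->
  4 * P ^+ 2 <= S ^+ 2 -> a ^+ 4 + S * a ^+ 2 + P ^+ 2 = 0 -> `|a| <= 2.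
Proof.
move=> S0 S4 Pr PS e.
have e2 : (2 * a ^+ 2 + S) ^+ 2 = S ^+ 2 - 4 * P ^+ 2.
  by rewrite -[RHS]addr0 -(mulr0 4) -e; ring.
have h : `|2 * a ^+ 2 + S| <= S.
  rewrite -(@ler_pXn2r _ 2) ?nnegrE // -normrX e2 ger0_norm ?subr_ge0 //.
  by rewrite lerBlDr lerDl mulr_ge0 // ?real_exprn_even_ge0.
have : `|2 * a ^+ 2| <= S + S.
  rewrite -{1}(addrK S (2 * a ^+ 2)); apply: le_trans (ler_normB _ _) _.
  by rewrite lerD // ger0_norm.
rewrite normrM normrX ger0_norm // => h2.
rewrite -(@ler_pXn2r _ 2) ?nnegrE // -(@ler_pM2l _ 2) //.
apply: le_trans h2 _; apply: le_trans (lerD S4 S4) _.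
by rewrite -natrD -natrX -natrM.
Qed.

(** An eigenvector, extended by zero to four coordinates, is an eigenvector of
    the 4 x 4 matrix, to which skew4_Cayley applies. *)
Lemma skew4_radius m n (Q : quiver n) (f : 'I_m -> 'I_n) (t : seq int) :
  bijective f -> (m <= 4)%N -> window_table (exchange_mx Q) f (skew4 t) ->
  (forall i j, (i < 4)%N -> (j < 4)%N -> ~~ ((i < m) && (j < m))%N -> skew4 t i j = 0) ->
  sum_sq t <= 4 -> 4 * pfaffian t ^+ 2 <= sum_sq t ^+ 2 ->
  exchange_spectrum_radius Q <= 2.
Proof.
move=> f_bij m4 rQ t0 S4 PS; apply/exchange_spectrum_radius_le => // a.
case/eigenvalueP => v va v0.
pose w : 'rV[algC]_4 := \row_i oapp (fun i : 'I_m => v 0 (f i)) 0 (insub (val i)).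
pose B : 'M[algC]_4 := map_mx intr (\matrix_(i < 4, j < 4) skew4 t i j).
have wB : w *m B = a *: w.
  apply/rowP => j; rewrite !mxE.
  case: (ltnP j m) => jm; last first.
    rewrite insubF ?ltnNge ?jm //= mulr0 big1 // => i _.
    by rewrite !mxE t0 ?mulr0 // [(j < m)%N]ltnNge jm andbF.
  rewrite insubT /=; move/rowP/(_ (f (Ordinal jm))): va; rewrite [in RHS]mxE => <-.
  rewrite mxE (reindex f) /=; last exact: onW_bij.
  pose G i := oapp (fun i : 'I_m => v 0 (f i)) 0 (insub i) * (skew4 t i j)%:~R.
  transitivity (\sum_(i < m) G i); last first.
    apply: eq_bigr => i _; rewrite /G valK /= -(rQ i (Ordinal jm)).
    by rewrite [map_mx _ _ _ _]mxE.
  rewrite (big_ord_widen _ G m4) [RHS]big_mkcond; apply: eq_bigr => i _.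
  rewrite !mxE /G; case: (ltnP i m) => // im.
  by rewrite insubF ?ltnNge ?im // mul0r.
have [j wj] : exists j, w 0 j != 0.
  have [g gK _] := f_bij.
  have /rV0Pn[x vx] : v != 0 by [].
  have [g' _ fK] := f_bij; exists (widen_ord m4 (g' x)).
  by rewrite mxE /= valK /= fK.
have wBB : w *m (B *m B) = a ^+ 2 *: w by rewrite mulmxA wB -scalemxAl wB scalerA.
have := congr1 (map_mx (intr : int -> algC)) (skew4_Cayley t).
rewrite !map_mxD map_mxZ !map_mxM map_scalar_mx map_mx0 -/B.
move=> /(congr1 (fun M => (w *m M) 0 j)).
rewrite !mulmxDr mulmx0 mulmxA wBB -scalemxAr wBB -scalemxAl wBB mul_mx_scalar.
rewrite !scalerA -!scalerDl => /eqP; rewrite [X in X == _]mxE [X in _ == X]mxE.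
rewrite mulf_eq0 (negPf wj) orbF -exprD.
move=> /eqP e; apply: (eigenvalue_bound (S := (sum_sq t)%:~R) (P := (pfaffian t)%:~R)) => //.
- by rewrite ler0z !addr_ge0 // sqr_ge0.
- by rewrite (ler_int _ _ 4).
- by rewrite realz.
- by rewrite -!rmorphXn -(intrM _ 4) ler_int.
- by rewrite -rmorphXn.
Qed.

(** * Dynkin quivers *)

Lemma nb_edgesE n (Q : cluster_quiver n) x y :
  nb_edges Q x y = (nb_arrows Q x y + nb_arrows Q y x)%N.
Proof.
rewrite /nb_edges /nb_arrows -cardsUI [X in (_ + X)%N](_ : _ = 0%N); last first.
  apply/eqP; rewrite cards_eq0; apply/eqP/setP => a; rewrite !inE.
  apply/negP => /andP[/andP[/eqP <- /eqP <-] /andP[/eqP e _]].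
  by case: (@cq_loopless _ Q a).
by rewrite addn0; apply: eq_card => a; rewrite !inE.
Qed.

Lemma nb_arrows_double n (Q : cluster_quiver n) x y :
  #|[set b : arrow (double_quiver Q) | (source b == x) && (target b == y)]| =
  nb_edges Q x y.
Proof.
rewrite nb_edgesE -sum1_card big_mkcond big_sumType /= -!big_mkcond !sum1_card /nb_arrows.
congr addn; apply: eq_card => a.
  by rewrite [LHS](in_set _ (inl a)) inE.
by rewrite [LHS](in_set _ (inr a)) inE andbC.
Qed.

Lemma exchange_mxE n (Q : cluster_quiver n) x y :
  nb_edges Q x y = 0%N -> exchange_mx Q x y = 0.
Proof. by rewrite nb_edgesE mxE => /eqP; rewrite addn_eq0 => /andP[/eqP -> /eqP ->]. Qed.

Lemma exchange_mx_sign n (Q : cluster_quiver n) x y :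
  nb_edges Q x y = 1%N -> exchange_mx Q x y \in [:: 1; -1].
Proof.
by rewrite nb_edgesE mxE; case: (nb_arrows _ _ _) => [|[|k]] //; case: (nb_arrows _ _ _) => [|[|l]].
Qed.

Section Subdiagram.
Variables (K : closedFieldType) (n : nat) (Q : cluster_quiver n.+1).
Hypothesis simple_edges : forall x y, (nb_edges Q x y <= 1)%N.
Variable i : nat -> 'I_n.+1.

Let adj x y := nb_edges Q x y == 1%N.
Let adjP x y : #|[set b : arrow (double_quiver Q) | (source b == x) && (target b == y)]|
  = adj x y.
Proof. by rewrite nb_arrows_double /adj; case: nb_edges (simple_edges x y) => [|[|]]. Qed.
Let adj_sym : symmetric adj.
Proof. by move=> x y; rewrite /adj !nb_edgesE addnC. Qed.

Let ord_inj m : {in gtn m &, injective i} -> injective (fun k : 'I_m => i k).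
Proof. by move=> i_inj k l /i_inj e; apply: val_inj; apply: e; rewrite inE /=. Qed.

Lemma star_excluded : {in gtn 4 &, injective i} ->
  (forall j k, (j < 4)%N -> (k < 4)%N ->
     nb_edges Q (i j) (i k) = ((j == 0%N) != (k == 0%N))) ->
  ~ representation_finite (preprojective K Q) /\ ~ two_maximal Q.
Proof.
move=> i_inj iE; split.
  apply: (@D4_representation_infinite K n Q adj adjP adj_sym i) => // j /andP[j0 j4].
  by rewrite /adj iE //; case: j j0 j4.
pose s := [seq exchange_mx Q (i 0%N) (i k) | k <- iota 1 3].
have /(allP star_stretches)/hasP[ks hks /hasP[x _ st]] : s \in signs 3.
  apply: mem_grid; apply/allP => _ /mapP[k /= hk ->].
  by apply: exchange_mx_sign; rewrite iE //; move: hk; rewrite !inE => /or3P[]/eqP->.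
apply: (stretches_not_two_maximal (ord_inj i_inj) _ _ st); last first.
  by move: hks; rewrite !inE => /orP[]/eqP ->.
have E0 j k : (j < 4)%N -> (k < 4)%N -> ((j == 0%N) == (k == 0%N)) ->
    exchange_mx Q (i j) (i k) = 0.
  by move=> j4 k4 e; apply: exchange_mxE; rewrite iE // e.
case=> [j j4] [k k4] /=; rewrite /star_table.
case: j j4 => [|j] j4; case: k k4 => [|k] k4 //=; try by rewrite E0.
- by rewrite (nth_map 0%N) ?size_iota ?nth_iota.
- by rewrite (exchange_mx_skew Q (i 0%N)) (nth_map 0%N) ?size_iota ?nth_iota.
Qed.

Lemma path_excluded : {in gtn 5 &, injective i} ->
  (forall j k, (j < 5)%N -> (k < 5)%N ->
     nb_edges Q (i j) (i k) = ((k == j.+1) || (j == k.+1))) ->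
  ~ representation_finite (preprojective K Q) /\ ~ two_maximal Q.
Proof.
move=> i_inj iE; split.
  apply: (@A5_representation_infinite K n Q adj adjP adj_sym i) => // j j4.
  by rewrite /adj iE ?eqxx // ltnW.
pose s := [seq exchange_mx Q (i k) (i k.+1) | k <- iota 0 4].
have /(allP path_stretches)/hasP[ks hks /hasP[x _ st]] : s \in signs 4.
  apply: mem_grid; apply/allP => _ /mapP[k /= hk ->].
  by apply: exchange_mx_sign; rewrite iE ?eqxx //; move: hk; rewrite !inE => /or4P[]/eqP->.
apply: (stretches_not_two_maximal (ord_inj i_inj) _ _ st); last first.
  by move: hks; rewrite !inE => /orP[]/eqP ->.
case=> [j j4] [k k4] /=; rewrite /path_table.
case: eqP => [ek|nk]; first by rewrite ek in k4 *; rewrite (nth_map 0%N) ?size_iota ?nth_iota.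
case: eqP => [ej|nj].
  by rewrite ej in j4 *; rewrite (exchange_mx_skew Q (i k)) (nth_map 0%N) ?size_iota ?nth_iota.
by apply: exchange_mxE; rewrite iE //; case: eqP => //; case: eqP.
Qed.

End Subdiagram.

(** Along any sequence of mutations the exchange matrix, read in the order of
    the line, stays in the list of mutation_class4P. *)
Lemma path_two_maximal n (Q : cluster_quiver n.+1) (s : 'S_n.+1) : (n < 4)%N ->
  (forall i j : 'I_n.+1, nb_edges Q (s i) (s j) = ((j == i.+1 :> nat) || (i == j.+1 :> nat))) ->
  two_maximal Q.
Proof.
move=> n4 sE Q' [ks [r [f [f_bij fE]]]].
have [|L [Lmut Lread Lbound Lzero Lpath]] := @mutation_class4P n.+1; first by [].
pose b := [seq exchange_mx Q (s (inord k)) (s (inord k.+1)) | k <- iota 0 n].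
have /Lpath[bL bE] : b \in signs n.
  rewrite -[n in signs n](size_iota 0).
  rewrite -(size_map (fun k => exchange_mx Q (s (inord k)) (s (inord k.+1)))).
  apply: mem_grid; apply/allP => _ /mapP[k /= hk ->].
  move: hk; rewrite mem_iota /= add0n => hk.
  by apply: exchange_mx_sign; rewrite sE !inordK ?eqxx // ltnW.
have rQ : window_table (exchange_mx Q) s (skew4 (path4 b)).
  move=> i j; rewrite -bE // /path_table.
  case: eqP => [ek|nk].
    have hi : (i < n)%N by rewrite -ltnS -ek ltn_ord.
    by rewrite (nth_map 0%N) ?size_iota // nth_iota // add0n -ek !inord_val.
  case: eqP => [ej|nj].
    rewrite (exchange_mx_skew Q (s j)).
    have hj : (j < n)%N by rewrite -ltnS -ej ltn_ord.
    by rewrite (nth_map 0%N) ?size_iota // nth_iota // add0n -ej !inord_val.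
  by apply: exchange_mxE; rewrite sE; case: eqP => //; case: eqP.
have [t tL rt] : exists2 t, t \in L &
    window_table (exchange_mx (foldl (@mutation n.+1) Q ks)) s (skew4 t).
  move: (path4 b) rQ bL; clear b bE sE Q' r f f_bij fE.
  elim: ks Q => [|k ks IH] Q t rQ tL /=.
    by exists t.
  have km : (s^-1%g k < n.+1)%N by [].
  apply: (IH _ (mutate4 t (s^-1%g k))); last exact: Lmut.
  move=> i j; have := window_mutate (s^-1%g k) perm_inj rQ.
  rewrite permKV exchange_mutation => ->.
  by apply: Lread => //; apply: leq_trans (ltn_ord _) n4.
pose g (i : 'I_n.+1) := r (s i).
have rt' : window_table (exchange_mx Q') g (skew4 t).
  have fnb x y : nb_arrows Q' (r x) (r y) = nb_arrows (foldl (@mutation n.+1) Q ks) x y.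
    rewrite /nb_arrows -(card_imset _ (bij_inj f_bij)); apply: eq_card => a'.
    have [f' fK f'K] := f_bij; rewrite -(f'K a') mem_imset; last exact: bij_inj.
    by have [e1 e2] := fE (f' a'); rewrite !inE e1 e2 !(inj_eq perm_inj).
  by move=> i j; rewrite /g -rt !mxE !fnb.
apply: (skew4_radius (f := g) _ _ rt').
- by exists (fun x => s^-1%g (r^-1%g x)) => x; rewrite /g ?permK ?permKV.
- exact: n4.
- by move=> i j i4 j4; apply: Lzero.
- by case: (Lbound _ tL).
- by case: (Lbound _ tL).
Qed.

Lemma path_representation_finite (K : fieldType) n (Q : cluster_quiver n.+1) (s : 'S_n.+1) :
  (n < 4)%N ->
  (forall i j : 'I_n.+1, nb_edges Q (s i) (s j) = ((j == i.+1 :> nat) || (i == j.+1 :> nat))) ->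
  representation_finite (preprojective K Q).
Proof.
move=> n4 sE.
pose adj x y := nb_edges Q x y == 1%N.
have adjP x y : #|[set b : arrow (double_quiver Q) | (source b == x) && (target b == y)]|
    = adj x y.
  by rewrite nb_arrows_double /adj -(permKV s x) -(permKV s y) sE; case: (_ || _).
pose e i : preprojective K Q := if (i < n.+1)%N then vertex_elt K Q (s (inord i)) else 0.
have eE (i : 'I_n.+1) : vertex_elt K Q (s i) = e i by rewrite /e ltn_ord inord_val.
apply: (@A4_representation_finite K _ e (arrow_sum K Q)).
- by move=> i; rewrite /e; case: ifP => _; rewrite ?mul0r // vertex_eltM eqxx.
- move=> i j ne; rewrite /e; case: ifP => hi; rewrite ?mul0r //.
  case: ifP => hj; rewrite ?mulr0 // vertex_eltM (inj_eq perm_inj).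
  by rewrite -val_eqE /= !inordK // (negPf ne).
- rewrite -(sum_vertex_elt K Q) (reindex s) /=; last first.
    by apply: onW_bij; exists s^-1%g => x; rewrite ?permK ?permKV.
  under [RHS]eq_bigr => i _ do rewrite eE.
  rewrite (big_ord_widen 4 e n4) [RHS]big_mkcond; apply: eq_bigr => i _.
  by rewrite /e; case: ifP.
- move=> i j h1 h2; rewrite /e; case: ifP => hi; rewrite ?mul0r //.
  case: ifP => hj; rewrite ?mulr0 // (corner_nonadj K adjP) //.
  by rewrite /adj sE !inordK // (negPf h1) (negPf h2).
- move=> i; rewrite /e; case: ifP => hi; rewrite ?mul0r //.
  exact: (corner_square K adjP).
- move=> M N f fD fZ fe fc; apply: (preproj_linear adjP) => // x y.
  rewrite -(permKV s x) eE; apply: fe; exact: leq_trans (ltn_ord _) n4.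
Qed.

Theorem corollary4p15 (K : closedFieldType) (n : nat) (Q : cluster_quiver n.+1)
    (hQ : dynkin_quiver Q) :
  representation_finite (preprojective K Q) <-> two_maximal Q.
Proof.
case: hQ => X rk [s sE].
have simple x y : (nb_edges Q x y <= 1)%N.
  by rewrite -(permKV s x) -(permKV s y) sE leq_b1.
suff: (representation_finite (preprojective K Q) /\ two_maximal Q) \/
      (~ representation_finite (preprojective K Q) /\ ~ two_maximal Q) by tauto.
have inj m (f : nat -> nat) : (forall i, (i < m)%N -> (f i < n.+1)%N) ->
    {in gtn m &, injective f} -> {in gtn m &, injective (fun i => s (inord (f i)))}.
  move=> fn fi i j im jm /perm_inj /(congr1 val) /=.
  rewrite !inordK ?fn //; exact: fi.
have starP (a : nat -> nat) : (forall i, (i < 4)%N -> (a i < n.+1)%N) ->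
    {in gtn 4 &, injective a} ->
    (forall j k, (j < 4)%N -> (k < 4)%N ->
       dynkin_adj X n.+1 (a j) (a k) = ((j == 0%N) != (k == 0%N))) ->
    ~ representation_finite (preprojective K Q) /\ ~ two_maximal Q.
  move=> an ai aE; apply: (star_excluded K simple (inj _ _ an ai)) => j k j4 k4.
  by rewrite sE !inordK ?an // aE.
case: X rk sE starP => /= rk sE starP.
- have [n4|n4] := ltnP n 4.
    left; split; first exact: path_representation_finite n4 sE.
    exact: path_two_maximal n4 sE.
  right; apply: (path_excluded K simple (inj 5 id _ _)) => [i i5|i j _ _ //|j k j5 k5].
    exact: leq_trans i5 _.
  by rewrite sE !inordK //; lia.
- right; apply: (starP (fun i => nth 0 [:: n - 2; n - 3; n - 1; n] i)%N).
  + by case=> [|[|[|[|]]]] //= _; lia.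
  + by case=> [|[|[|[|]]]] // [|[|[|[|]]]] //= _ _; lia.
  + by case=> [|[|[|[|]]]] // [|[|[|[|]]]] //= _ _; rewrite /dynkin_adj /= /branched_edge; repeat case: ifP; lia.
- right; apply: (starP (fun i => nth 0 [:: 2; 1; 3; n] i)%N).
  + by case=> [|[|[|[|]]]] //= _; lia.
  + by case=> [|[|[|[|]]]] // [|[|[|[|]]]] //= _ _; lia.
  + by case=> [|[|[|[|]]]] // [|[|[|[|]]]] //= _ _; rewrite /dynkin_adj /= /branched_edge; repeat case: ifP; lia.
Qed.
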